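(* Let $\mathcal C$ be a simple closed $C^2$ curve in $\mathbb R^2$ of length $L$, with unit-speed counter-clockwise parametrization $\mathbf X(s)=(x(s),y(s))$, $s\in[0,L]$, bounding a domain $\Omega$ of area $A$. Let $\mathbf T=\frac{d\mathbf X}{ds}$, let $\mathbf N=-J\mathbf T$ be the outward unit normal ($J$ the counter-clockwise rotation by $\pi/2$), let $\mathbf G=\frac1L\int_{\mathcal C}\mathbf X\,ds$ be the center of gravity of $\mathcal C$, and let $\kappa$ be the signed curvature, so that $\frac{d^2\mathbf X}{ds^2}=-\kappa\mathbf N$. Then (a) $$0\le (L^2-4\pi A)-\frac{2\pi^2}{L}\int_{\mathcal C}\Big|\mathbf X-\mathbf G-\frac{L}{2\pi}\mathbf N\Big|^2ds\le \frac{2\pi^2}{3L}\int_{\mathcal C}\Big|\mathbf X-\mathbf G-\Big(\frac{L}{2\pi}\Big)^2\kappa\mathbf N\Big|^2ds;$$ (b) $$0\le \frac{L^3}{4\pi^2}-\int_{\mathcal C}|\mathbf X-\mathbf G|^2ds\le \frac{L^4}{64\pi^4}\Big(\int_{\mathcal C}\kappa^2\,ds-\frac{4\pi^2}{L}\Big).$$ Each of these four inequalities becomes an equality if and only if $\mathcal C$ is a circle. *)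

(* Defs.v *)
From HB Require Import structures.
From mathcomp Require Import all_boot all_order all_algebra.
From mathcomp Require Import all_classical all_reals all_analysis.
Set Implicit Arguments. Unset Strict Implicit. Unset Printing Implicit Defensive.
Import Order.TTheory GRing.Theory Num.Theory.
Import numFieldNormedType.Exports.
Local Open Scope classical_set_scope.
Local Open Scope ring_scope.

Section Defs.
Variable R : realType.
Implicit Types (x y f : R -> R) (L : R) (p : R * R).

Definition sint L f : R := Rintegral (@lebesgue_measure R) `[0, L] f.

Definition curve_set x y L : set (R * R) :=
  [set (x s, y s) | s in `[0, L]].

Definition sqnorm (a b : R) : R := a ^+ 2 + b ^+ 2.

(* unit tangent T = X' ; outward normal N = - J T = (y', -x') *)
Definition Nx y : R -> R := fun s => (derive1 y) s.
Definition Ny x : R -> R := fun s => - (derive1 x) s.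

(* signed curvature kappa, defined by X'' = - kappa N (for unit speed) *)
Definition curvature x y : R -> R :=
  fun s => (derive1 x) s * derive1 (derive1 y) s - (derive1 y) s * derive1 (derive1 x) s.

Definition Gx x L : R := L^-1 * sint L x.
Definition Gy y L : R := L^-1 * sint L y.

Definition winding x y L p : R :=
  (2 * pi)^-1 * sint L (fun s =>
     ((x s - p.1) * (derive1 y) s - (y s - p.2) * (derive1 x) s) /
     sqnorm (x s - p.1) (y s - p.2)).

Definition bounded2 (S : set (R * R)) : Prop :=
  exists M : R, forall q, S q -> `|q.1| <= M /\ `|q.2| <= M.

Definition enclosed x y L : set (R * R) :=
  [set p | ~ curve_set x y L p /\
           bounded2 (connected_component (~` curve_set x y L) p)].

Definition area2 (S : set (R * R)) : \bar R :=
  ((@lebesgue_measure R) \x (@lebesgue_measure R))%E S.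

Definition is_circle (S : set (R * R)) : Prop :=
  exists (c : R * R) (r : R), 0 < r /\
    S = [set p | sqnorm (p.1 - c.1) (p.2 - c.2) = r ^+ 2].

Definition C2_closed_unit_speed x y L : Prop :=
  0 < L /\
  (forall s, derivable x s 1 /\ derivable y s 1 /\
             derivable (derive1 x) s 1 /\ derivable (derive1 y) s 1) /\
  continuous (derive1 (derive1 x)) /\ continuous (derive1 (derive1 y)) /\
  (forall s, x (s + L) = x s /\ y (s + L) = y s) /\
  (forall s, sqnorm ((derive1 x) s) ((derive1 y) s) = 1).

Definition simple_on x y L : Prop :=
  forall s t, s \in `[0, L[ -> t \in `[0, L[ ->
    (x s, y s) = (x t, y t) -> s = t.

Definition ccw x y L : Prop :=
  forall p, enclosed x y L p -> winding x y L p = 1.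

End Defs.

(* Main.v *)
(** With [w = 2 pi / L], put [P = L - w^2 int |X - G|^2] and
    [Q = int |X''|^2 - 5 w^2 int |X'|^2 + 4 w^4 int |X - G|^2].  Expanding the
    squares and integrating by parts (here [int <X - G, N> = 2 A] enters), the
    two middle terms are positive multiples of [P], and the two upper bounds
    exceed them by positive multiples of [Q].  In Fourier modes, [P] and [Q] have
    the weights [w^2 (n^2 - 1)] and [w^4 (n^2 - 1) (n^2 - 4)], both nonnegative;
    [P >= 0] is Wirtinger's inequality, and [Q >= 0] follows from the inequality
    [int f'^2 >= 4 w^2 int f^2] for [f] without modes 0 and 1.  No Fourier series
    is needed for the latter: some [f - a - b cos - c sin] has four equidistant
    zeros, and the Dirichlet inequality applies between consecutive ones.
    If [P] or [Q] vanishes, the curve has only the modes 1 and 2; unit speed then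
    kills one of the two, and mode 2 alone would run through a circle twice.

    The enclosed area is only given as a Lebesgue measure, so
    [A = - int x' y] has to be derived from the winding number: by local
    constancy it vanishes off the enclosed set, where it is 1 by hypothesis.
    Hence [2 pi A] is the integral of the winding kernel over a long box times
    [[0, L]], and Fubini together with an explicit integration of the kernel
    along horizontal lines gives [- 2 pi int x' y] up to an error that vanishes
    as the box gets longer. *)

Require Import Defs.
From HB Require Import structures.
From mathcomp Require Import all_boot all_order all_algebra.
From mathcomp Require Import all_classical all_reals all_analysis.
From mathcomp Require Import measurable_realfun ring lra.
Set Implicit Arguments. Unset Strict Implicit. Unset Printing Implicit Defensive.
Import Order.TTheory GRing.Theory Num.Theory.
Import numFieldNormedType.Exports.
Local Open Scope classical_set_scope.
Local Open Scope ring_scope.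

(** * Continuity, derivatives and integrals on the line *)

Section Calculus.
Variable R : realType.
Implicit Types (f g F : R -> R) (a b c s : R).

(** The delicate point of the area computation is absolute integrability: the winding kernel blows
    up like the inverse distance to the curve point, and along the horizontal line through that
    point it is in general not integrable at all. Its two terms are therefore treated separately.
    Each is, up to a factor of modulus at most 1, [pi] times a Poisson kernel in one of the two
    coordinates, so its absolute integral in that coordinate is at most [pi], uniformly in
    everything else; this is what licenses Fubini. The area itself comes from a jump: over long
    symmetric horizontal segments the kernel integrates nearly to [- pi x'] below the curve point
    and to [pi x'] above it. Since the enclosed set is described through connected components, even
    its measurability has to be extracted from the same integral, as that of a level set. *)

Lemma cont_cst c : continuous (fun _ : R => c).
Proof. by move=> s; exact: cvg_cst. Qed.

Lemma cont_id : continuous (fun s : R => s).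
Proof. by move=> s; exact: cvg_id. Qed.

Lemma contD f g : continuous f -> continuous g ->
  continuous (fun s => f s + g s).
Proof. by move=> cf cg s; apply: cvgD; [exact: cf|exact: cg]. Qed.

Lemma contN f : continuous f -> continuous (fun s => - f s).
Proof. by move=> cf s; apply: cvgN; exact: cf. Qed.

Lemma contM f g : continuous f -> continuous g ->
  continuous (fun s => f s * g s).
Proof. by move=> cf cg s; apply: cvgM; [exact: cf|exact: cg]. Qed.

Lemma contX f n : continuous f -> continuous (fun s => f s ^+ n).
Proof.
move=> cf; elim: n => [|n IH].
  by under eq_fun do rewrite expr0; exact: cont_cst.
by under eq_fun do rewrite exprS; exact: contM.
Qed.

Lemma contV f : (forall s, f s != 0) -> continuous f ->
  continuous (fun s => (f s)^-1).
Proof. by move=> f0 cf s; apply: cvgV => //; exact: cf. Qed.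

Lemma cont_comp f g : continuous f -> continuous g ->
  continuous (fun s => f (g s)).
Proof. by move=> cf cg s; apply: (continuous_comp (cg s) (cf _)). Qed.

(* [is_derive] is a type class: the plain constant keeps rewriting from
   resolving it. *)
Definition has_der s f a : Prop := is_derive s 1 f a.

Lemma has_der_eq s f a b : has_der s f a -> a = b -> has_der s f b.
Proof. by move=> + <-. Qed.

Lemma der_cst c s : has_der s (fun _ : R => c) 0.
Proof. exact: is_derive_cst. Qed.

Lemma der_id s : has_der s (fun t : R => t) 1.
Proof. exact: is_derive_id. Qed.

Lemma derD f g s a b : has_der s f a -> has_der s g b ->
  has_der s (fun t => f t + g t) (a + b).
Proof. by move=> df dg; exact: is_deriveD. Qed.

Lemma derN f s a : has_der s f a -> has_der s (fun t => - f t) (- a).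
Proof. by move=> df; exact: is_deriveN. Qed.

Lemma derM f g s a b : has_der s f a -> has_der s g b ->
  has_der s (fun t => f t * g t) (a * g s + f s * b).
Proof.
move=> df dg; have := @is_deriveM _ _ f g s 1 a b df dg.
by move=> d; apply: (has_der_eq d); rewrite /GRing.scale /=; ring.
Qed.

Lemma derX2 f s a : has_der s f a ->
  has_der s (fun t => f t ^+ 2) (2 * f s * a).
Proof.
move=> df; have -> : (fun t => f t ^+ 2) = (fun t => f t * f t).
  by apply/funext => t; rewrite expr2.
by apply: (has_der_eq (derM df df)); ring.
Qed.

Lemma derV f s a : f s != 0 -> has_der s f a ->
  has_der s (fun t => (f t)^-1) (- a / f s ^+ 2).
Proof.
move=> f0 df; apply: (has_der_eq (is_deriveV f0 df)).
by rewrite /GRing.scale /=; field.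
Qed.

Lemma der_comp f g s a b : has_der (g s) f a -> has_der s g b ->
  has_der s (fun t => f (g t)) (a * b).
Proof. by move=> df dg; exact: (is_derive1_comp df dg). Qed.

Lemma der_cos g s b : has_der s g b ->
  has_der s (fun t => cos (g t)) (- sin (g s) * b).
Proof. by apply: der_comp; exact: is_derive_cos. Qed.

Lemma der_sin g s b : has_der s g b ->
  has_der s (fun t => sin (g t)) (cos (g s) * b).
Proof. by apply: der_comp; exact: is_derive_sin. Qed.

Lemma der_cont f (f' : R -> R) : (forall s, has_der s f (f' s)) ->
  continuous f.
Proof.
move=> df s; apply/differentiable_continuous/derivable1_diffP.
by have [] := df s.
Qed.

Lemma cont_cos g : continuous g -> continuous (fun s => cos (g s)).
Proof. by move=> cg; apply: (@cont_comp cos) => //; exact: continuous_cos. Qed.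

Lemma cont_sin g : continuous g -> continuous (fun s => sin (g s)).
Proof. by move=> cg; apply: (@cont_comp sin) => //; exact: continuous_sin. Qed.

End Calculus.

Ltac cont := repeat match goal with
  | |- continuous (fun _ => ?c) => exact: cont_cst
  | |- continuous (fun s => s) => exact: cont_id
  | |- continuous (fun s => _ + _) => apply: contD
  | |- continuous (fun s => - _) => apply: contN
  | |- continuous (fun s => _ * _) => apply: contM
  | |- continuous (fun s => _ ^+ _) => apply: contX
  | |- continuous (-%R) => exact: (contN (@cont_id _))
  | |- continuous ( *%R ?k) => change (continuous (fun s => k * s))
  | |- continuous (fun s => cos _) => apply: cont_cos
  | |- continuous (fun s => sin _) => apply: cont_sin
  | H : continuous ?f |- continuous ?f => exact: H
  | H : continuous ?f |- continuous (fun s => ?f s) => exact: H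
  end.

Ltac conts := repeat match goal with |- _ /\ _ => split end;
  try exact: Logic.I; cont.

(** The derivative starts as an unknown, is assembled by the syntactic rules, and is equated with
    the stated one only at the end, so that what remains is usually a [ring] or [field] identity. *)
Ltac der := eapply has_der_eq; [
  repeat match goal with
  | |- has_der _ (fun _ => ?c) _ => exact: der_cst
  | |- has_der _ (fun s => s) _ => exact: der_id
  | |- has_der _ (fun s => _ + _) _ => apply: derD
  | |- has_der _ (fun s => - _) _ => apply: derN
  | |- has_der _ (fun s => _ ^+ 2) _ => apply: derX2
  | |- has_der _ (fun s => _ * _) _ => apply: derM
  | |- has_der _ (-%R) _ => exact: (derN (der_id _))
  | |- has_der ?s ( *%R ?k) ?a => change (has_der s (fun t => k * t) a)
  | |- has_der _ (fun s => cos _) _ => apply: der_cos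
  | |- has_der _ (fun s => sin _) _ => apply: der_sin
  | H : forall s, has_der s ?f _ |- has_der _ ?f _ => exact: H
  | H : forall s, has_der s ?f _ |- has_der _ (fun s => ?f s) _ => exact: H
  | H : has_der _ ?f _ |- has_der _ ?f _ => exact: H
  | H : has_der _ ?f _ |- has_der _ (fun s => ?f s) _ => exact: H
  end | cbv beta ].

Section Integral.
Variable R : realType.
Implicit Types (f g F : R -> R) (a b c s : R).

Definition itg a b f : R := Rintegral (@lebesgue_measure R) `[a, b] f.

Lemma cont_itg_integrable f a b : continuous f ->
  (@lebesgue_measure R).-integrable `[a, b] (EFin \o f).
Proof.
move=> cf; apply: continuous_compact_integrable; first exact: segment_compact.
exact: continuous_subspaceT.
Qed.

Lemma itg_FTC f F a b : a <= b -> continuous f ->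
  (forall s, a <= s <= b -> has_der s F (f s)) -> itg a b f = F b - F a.
Proof.
rewrite le_eqVlt => /predU1P[<- cf _|ab cf dF].
  by rewrite /itg set_itv1 Rintegral_set1 subrr.
have cF s : a <= s <= b -> {for s, continuous F}.
  move=> /dF [dFs _].
  exact/differentiable_continuous/derivable1_diffP.
rewrite /itg /Rintegral (@continuous_FTC2 _ f F) //.
- exact: continuous_subspaceT.
- split.
  + move=> s; rewrite in_itv /= => /andP[as_ sb].
    by have [] : has_der s F (f s) by apply: dF; rewrite !ltW.
  + by apply: cvg_at_right_filter; apply: cF; rewrite lexx ltW.
  + by apply: cvg_at_left_filter; apply: cF; rewrite lexx ltW.
- move=> s; rewrite in_itv /= => /andP[as_ sb]; rewrite derive1E.
  by have [_ ->] : has_der s F (f s) by apply: dF; rewrite !ltW.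
Qed.

(** The primitive is the integral from [a], so it is controlled only to the right of [a]; callers
    start it one unit earlier to have two-sided derivatives at the ends of their interval. *)
Lemma primitive_right f a : continuous f ->
  exists F, forall s, a < s -> has_der s F (f s).
Proof.
move=> cf; exists (fun t => itg a t f) => s as_.
have s1 : s < s + 1 by rewrite ltrDl.
have [] := @continuous_FTC1_closed _ f a s (s + 1) s1
  (cont_itg_integrable a (s + 1) cf) as_ (cf s).
by move=> dF F'; apply: DeriveDef; [exact: dF|rewrite -[RHS]F' derive1E].
Qed.

Lemma itg_chasles f a b c : a <= b -> b <= c -> continuous f ->
  itg a c f = itg a b f + itg b c f.
Proof.
move=> ab bc cf; have [F dF] := primitive_right (a - 1) cf.
have E u v : a <= u -> u <= v -> itg u v f = F v - F u.
  by move=> au uv; apply: itg_FTC => // s /andP[us _]; apply: dF; lra.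
by rewrite (E a c (lexx a) (le_trans ab bc)) (E a b (lexx a) ab) (E b c ab bc); ring.
Qed.

Lemma itg_shift f a b c : a <= b -> continuous f ->
  itg (a + c) (b + c) f = itg a b (fun s => f (s + c)).
Proof.
move=> ab cf; have [F dF] := primitive_right (a + c - 1) cf.
transitivity (F (b + c) - F (a + c)).
  apply: itg_FTC => //; first by rewrite lerD2r.
  by move=> s /andP[bs _]; apply: dF; lra.
apply/esym/(@itg_FTC _ (fun s => F (s + c))) => //.
  by apply: (@cont_comp _ f) => //; cont.
move=> s /andP[as_ _]; have : has_der (s + c) F (f (s + c)).
  by apply: dF; lra.
move=> dFs; have dc := derD (der_id s) (der_cst c s).
by apply: (has_der_eq (@der_comp R F (fun t => t + c) s _ _ dFs dc)); ring.
Qed.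

Lemma eq_itg f g a b : (forall s, f s = g s) -> itg a b f = itg a b g.
Proof. by move=> fg; apply: eq_Rintegral => s _; exact: fg. Qed.

Lemma itgD f g a b : continuous f -> continuous g ->
  itg a b (fun s => f s + g s) = itg a b f + itg a b g.
Proof. by move=> cf cg; apply: RintegralD => //; exact: cont_itg_integrable. Qed.

Lemma itgZ f c a b : continuous f ->
  itg a b (fun s => c * f s) = c * itg a b f.
Proof. by move=> cf; apply: RintegralZl => //; exact: cont_itg_integrable. Qed.

Lemma itg_cst c a b : a <= b -> itg a b (fun _ => c) = c * (b - a).
Proof.
move=> ab; transitivity (c * b - c * a); last by ring.
apply: (@itg_FTC _ (fun s => c * s)) => //; first by cont.
by move=> s _; der; ring.
Qed.

(** Integrals are expanded by listing coefficients and functions: [itg_lcomb] then leaves one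
    continuity goal and one pointwise identity instead of a chain of linearity rewrites. *)
Fixpoint lcomb (l : seq (R * (R -> R))) s : R :=
  if l is (c, f) :: l' then c * f s + lcomb l' s else 0.

Fixpoint litg a b (l : seq (R * (R -> R))) : R :=
  if l is (c, f) :: l' then c * itg a b f + litg a b l' else 0.

Fixpoint lcont (l : seq (R * (R -> R))) : Prop :=
  if l is (_, f) :: l' then continuous f /\ lcont l' else True.

Lemma itg_lcomb l g a b : lcont l -> (forall s, g s = lcomb l s) ->
  itg a b g = litg a b l.
Proof.
move=> cl /eq_itg ->; suff [_ ->] : continuous (lcomb l) /\
    itg a b (lcomb l) = litg a b l by [].
elim: l cl => [_|[c f] l IH [cf /IH[cl E]]] /=; last rewrite -E.
  split; first exact: cont_cst.
  (* Written as [0 * 0], the zero function falls under [itgZ], whereas [itg_cst] would ask for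
     [a <= b]. *)
  by rewrite (eq_itg (g := fun s => 0 * 0)) ?itgZ ?mul0r //; cont.
split; first by cont.
by rewrite itgD ?itgZ //; cont.
Qed.

Lemma itg_ge0 f a b : (forall s, a <= s <= b -> 0 <= f s) -> 0 <= itg a b f.
Proof. by move=> f0; apply: Rintegral_ge0 => s /=; rewrite in_itv; exact: f0. Qed.

Lemma le_itg f g a b : continuous f -> continuous g ->
  (forall s, a <= s <= b -> f s <= g s) -> itg a b f <= itg a b g.
Proof.
move=> cf cg fg; apply: le_Rintegral => //; exact: cont_itg_integrable.
Qed.

Lemma itg_eq0 f a b : a < b -> continuous f ->
  (forall s, a <= s <= b -> 0 <= f s) -> itg a b f = 0 ->
  forall s, a <= s <= b -> f s = 0.
Proof.
move=> ab cf f0 I0 s sab; apply/eqP; rewrite eq_le f0 // andbT leNgt.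
apply/negP => fs0.
have : \forall t \near s, f s / 2 < f t by apply: (cvgr_gt _ (cf s)); lra.
move=> /nbhs_ballP[e /= e0 be].
(* The interval is cut to [[a, b]] and keeps positive length even when [s] is an endpoint, because
   [a < b]. Half the radius puts the closed interval inside the open ball. *)
pose c := Num.max a (s - e / 2); pose d := Num.min b (s + e / 2).
have [ac cd db] : [/\ a <= c, c < d & d <= b].
  move: sab => /andP[? ?]; rewrite /c /d lt_min !gt_max le_max ge_min !lexx.
  by split => //; lra.
have cs t : c <= t <= d -> f s / 2 <= f t.
  move=> /andP[? ?]; apply/ltW/be; rewrite /ball /= ltr_distl.
  have : c >= s - e / 2 /\ d <= s + e / 2.
    by rewrite /c /d le_max ge_min !lexx !orbT.
  by move=> [? ?]; lra.
have : (f s / 2) * (d - c) <= itg c d f.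
  by rewrite -itg_cst ?(ltW cd) //; apply: le_itg => //; cont.
have : 0 < (f s / 2) * (d - c) by apply: mulr_gt0; lra.
have : itg a b f = itg a c f + (itg c d f + itg d b f).
  by rewrite -!itg_chasles //; lra.
have : 0 <= itg a c f by apply: itg_ge0 => t ?; apply: f0; lra.
have : 0 <= itg d b f by apply: itg_ge0 => t ?; apply: f0; lra.
lra.
Qed.

Lemma le_norm_itg f a b c : a <= b -> continuous f ->
  (forall s, a <= s <= b -> `|f s| <= c) -> `|itg a b f| <= c * (b - a).
Proof.
move=> ab cf fc; rewrite -itg_cst // ler_norml -[X in - X]mul1r -mulNr.
rewrite -itgZ; last by cont.
by apply/andP; split; apply: le_itg => //; cont => s /fc; rewrite ler_norml; lra.
Qed.

End Integral.

(** * Wirtinger inequalities *)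

Section Wirtinger.
Variable R : realType.
Implicit Types (f g h : R -> R) (a b c s w L : R).

(** Jacobi's trick: with [t = tan (nu (s - m))], adding the derivative of [nu h^2 t] to
    [h1^2 - nu^2 h^2] gives the square [(h1 + nu h t)^2], and the added boundary term vanishes with
    [h]. The strict bound on [nu * (b - a)] keeps the tangent finite on the closed interval centred
    at [m]. *)
Lemma dirichlet_wirtinger_lt h h1 a b (nu : R) : a < b -> continuous h1 ->
  (forall s, has_der s h (h1 s)) -> h a = 0 -> h b = 0 ->
  0 <= nu -> nu * (b - a) < pi ->
  nu ^+ 2 * itg a b (fun s => h s ^+ 2) <= itg a b (fun s => h1 s ^+ 2).
Proof.
move=> ab ch1 dh ha hb nu0 nupi; have ch := der_cont dh.
have ab' := ltW ab.
pose m := (a + b) / 2.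
have cosN0 s : a <= s <= b -> cos (nu * (s - m)) != 0.
  move=> /andP[as_ sb]; apply/lt0r_neq0/cos_gt0_pihalf.
  have H1 : nu * (a - m) <= nu * (s - m) by apply: ler_wpM2l => //; lra.
  have H2 : nu * (s - m) <= nu * (b - m) by apply: ler_wpM2l => //; lra.
  have H3 : nu * (b - m) = nu * (b - a) / 2 by rewrite /m; field.
  have H4 : nu * (a - m) = - (nu * (b - a) / 2) by rewrite /m; field.
  by apply/andP; split; lra.
clearbody m; pose P s := h1 s ^+ 2 - nu ^+ 2 * h s ^+ 2.
have cP : continuous P by rewrite /P; cont.
have [F dF] := primitive_right (a - 1) cP.
pose G s := F s + nu * (h s ^+ 2 * tan (nu * (s - m))).
have dG s : a <= s <= b ->
    has_der s G ((h1 s + nu * (h s * tan (nu * (s - m)))) ^+ 2).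
  move=> sab; have c0 := cosN0 s sab.
  have d1 : has_der s F (P s) by apply: dF; move/andP: sab; lra.
  have d2 : has_der s (fun t => nu * (t - m)) nu by der; ring.
  have d3 : has_der s (fun t => tan (nu * (t - m)))
      ((1 + tan (nu * (s - m)) ^+ 2) * nu).
    apply: (@der_comp _ (@tan R) (fun t => nu * (t - m))) => //.
    by rewrite -cos2_tan2 //; exact: is_derive_tan.
  by rewrite /G; der; rewrite /P; ring.
(* The mean value theorem gives [G a <= G b] from the sign of the derivative alone; [itg_FTC] would
   want the square continuous on the whole line, where the tangent has poles. *)
have [||c cab] := @MVT_segment _ G
  (fun s => (h1 s + nu * (h s * tan (nu * (s - m)))) ^+ 2) a b ab'.
- by move=> s sab; apply: dG; move: sab; rewrite in_itv /= => /andP[? ?]; rewrite !ltW.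
- apply: continuous_in_subspaceT => s; rewrite inE /= in_itv /= => sab.
  by have [dGs _] := dG s sab; exact/differentiable_continuous/derivable1_diffP.
rewrite /G ha hb expr0n /= !mul0r !mulr0 !addr0 => FE.
have : itg a b P = F b - F a.
  by apply: itg_FTC => // s /andP[? ?]; apply: dF; lra.
rewrite (@itg_lcomb _ [:: (1, fun s => h1 s ^+ 2); (- nu ^+ 2, fun s => h s ^+ 2)]) /=.
- rewrite FE mul1r addr0 => E.
  have : 0 <= (h1 c + nu * (h c * tan (nu * (c - m)))) ^+ 2 * (b - a).
    by rewrite mulr_ge0 ?sqr_ge0 ?subr_ge0.
  by rewrite -E; lra.
- by conts.
- by move=> s; rewrite /P; ring.
Qed.

(** In the limiting case [nu * (b - a) = pi] the tangent blows up at both ends, so the strict case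
    is applied to a slightly smaller frequency. *)
Lemma dirichlet_wirtinger h h1 a b (nu : R) : a < b -> continuous h1 ->
  (forall s, has_der s h (h1 s)) -> h a = 0 -> h b = 0 ->
  0 <= nu -> nu * (b - a) <= pi ->
  nu ^+ 2 * itg a b (fun s => h s ^+ 2) <= itg a b (fun s => h1 s ^+ 2).
Proof.
move=> ab ch1 dh ha hb nu0 nupi; rewrite leNgt; apply/negP.
set I1 := itg _ _ _; set I0 := itg _ _ _ => I10.
have I0_ge0 : 0 <= I0 by apply: itg_ge0 => s _; exact: sqr_ge0.
have I1_ge0 : 0 <= I1 by apply: itg_ge0 => s _; exact: sqr_ge0.
set X := nu ^+ 2 * I0 in I10; have X0 : 0 < X := le_lt_trans I1_ge0 I10.
have nuN0 : nu != 0 by apply/eqP => nuE; move: X0; rewrite /X nuE expr0n mul0r ltxx.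
have nu_gt0 : 0 < nu by rewrite lt_def nuN0.
(* With this [d], [(1 - d)^2 X >= X - 2 d X = (X + I1) / 2 > I1], so the frequency [(1 - d) * nu]
   already contradicts the strict case. *)
pose d := (X - I1) / (4 * X).
have d0 : 0 < d by apply: divr_gt0; lra.
have dX : d * X = (X - I1) / 4 by rewrite /d; field; lra.
have d1 : d < 1.
  by rewrite /d ltr_pdivrMr; lra.
have : ((1 - d) * nu) ^+ 2 * I0 <= I1.
  apply: dirichlet_wirtinger_lt => //; first by apply: mulr_ge0; lra.
  rewrite -mulrA; apply: lt_le_trans nupi.
  by rewrite gtr_pMl ?mulr_gt0 ?subr_gt0 //; lra.
have -> : ((1 - d) * nu) ^+ 2 * I0 = X - 2 * (d * X) + d ^+ 2 * X.
  by rewrite /X; ring.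
have : 0 <= d ^+ 2 * X by rewrite mulr_ge0 ?sqr_ge0 // ltW.
rewrite dX; lra.
Qed.

(** The difference [u] from the explicit solution has conserved energy [u'^2 + k^2 u^2], which is
    zero at time 0. *)
Lemma harmonic_ode (k : R) f f1 f2 : k != 0 ->
  (forall s, has_der s f (f1 s)) -> (forall s, has_der s f1 (f2 s)) ->
  (forall s, f2 s = - k ^+ 2 * f s) ->
  forall s, f s = f 0 * cos (k * s) + f1 0 / k * sin (k * s).
Proof.
move=> k0 df df1 fE s.
pose u t := f t - (f 0 * cos (k * t) + f1 0 / k * sin (k * t)).
pose v t := f1 t - (- (f 0 * k) * sin (k * t) + f1 0 * cos (k * t)).
have du t : has_der t u (v t).
  by rewrite /u /v; der; field.
have dv t : has_der t v (- k ^+ 2 * u t).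
  by rewrite /u /v; der; rewrite fE; field.
pose N t := v t ^+ 2 + k ^+ 2 * u t ^+ 2.
have dN t : has_der t N 0 by rewrite /N; der; ring.
have : N s = N 0 by exact: is_derive_0_is_cst.
have -> : N 0 = 0.
  by rewrite /N /u /v mulr0 cos0 sin0; ring.
have uv2 : 0 <= v s ^+ 2 by exact: sqr_ge0.
have : 0 <= k ^+ 2 * u s ^+ 2 by rewrite -exprMn sqr_ge0.
rewrite /N => ? ?; have : (k * u s) ^+ 2 = 0 by rewrite exprMn; lra.
by move/eqP; rewrite sqrf_eq0 mulf_eq0 (negPf k0) /= subr_eq0 => /eqP.
Qed.

(** One representative [t] serves all [L]-periodic functions at once, so both coordinates of the
    curve can be moved to the same parameter. *)
Lemma periodic_rep L s : 0 < L -> exists2 t, 0 <= t <= L &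
  forall (U : Type) (f : R -> U), (forall r, f (r + L) = f r) -> f s = f t.
Proof.
move=> L0; have /andP[] := floor_itv (s / L).
rewrite ler_pdivlMr // ltr_pdivrMr // intrD mulrDl mul1r => ? ?.
exists (s - (Num.floor (s / L))%:~R * L); first by apply/andP; split; lra.
move=> U f fL; have fn (n : nat) t : f (t + n%:R * L) = f t.
  elim: n t => [|n IH] t; first by rewrite mul0r addr0.
  by rewrite -natr1 mulrDl mul1r addrA fL.
have fz (z : int) t : f (t + z%:~R * L) = f t.
  case: z => n; first exact: fn.
  by rewrite -[LHS](fn n.+1) NegzE mulrNz -pmulrn; congr f; ring.
by rewrite -[RHS](fz (Num.floor (s / L))); congr f; ring.
Qed.

Lemma periodic_eq0 f L : 0 < L -> (forall s, f (s + L) = f s) ->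
  (forall s, 0 <= s <= L -> f s = 0) -> forall s, f s = 0.
Proof.
move=> L0 fL f0 s; have [t tL ft] := periodic_rep s L0.
by rewrite (ft _ f fL) f0.
Qed.

Lemma der_periodic f f1 L : (forall s, has_der s f (f1 s)) ->
  (forall s, f (s + L) = f s) -> forall s, f1 (s + L) = f1 s.
Proof.
move=> df fL s; have d : has_der s f (f1 (s + L)).
  have -> : f = (fun t => f (t + L)) by apply/funext => t; rewrite fL.
  have dL : has_der s (fun t => t + L) 1 by der; ring.
  by apply: has_der_eq (@der_comp _ f (fun t => t + L) s _ _ (df _) dL) _; ring.
by have [_ <-] := d; have [_ <-] := df s.
Qed.

Lemma itg_der_periodic f f1 L : 0 <= L -> continuous f1 ->
  (forall s, has_der s f (f1 s)) -> f L = f 0 -> itg 0 L f1 = 0.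
Proof.
move=> L0 cf1 df fL; transitivity (f L - f 0); last by rewrite fL subrr.
by apply: itg_FTC => // s _; exact: df.
Qed.

Lemma itg_periodic f a L : 0 <= a -> a <= L -> continuous f ->
  (forall s, f (s + L) = f s) -> itg a (a + L) f = itg 0 L f.
Proof.
move=> a0 aL cf fL.
rewrite (@itg_chasles _ f a L) //; last by lra.
rewrite (@itg_chasles _ f 0 a L) // addrC; congr (_ + _).
by rewrite -{1}(add0r L) itg_shift //; apply: eq_itg.
Qed.

End Wirtinger.

(** * Trigonometric modes and the inequality beyond the first mode *)

Section Modes.
Variable R : realType.
Variables (L w : R).
Hypotheses (L0 : 0 < L) (wL : w * L = 2 * pi).
Implicit Types (f g h : R -> R) (a b c s : R).

Let L0' : 0 <= L := ltW L0.

Lemma w_gt0 : 0 < w.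
Proof. by rewrite -(pmulr_lgt0 _ L0) wL mulr_gt0 // pi_gt0. Qed.

Let w0 : w != 0 := lt0r_neq0 w_gt0.

Lemma cos_periodic s : cos (w * (s + L)) = cos (w * s).
Proof. by rewrite mulrDr wL (_ : 2 * pi = pi *+ 2) ?cosD2pi // mulr_natl. Qed.

Lemma sin_periodic s : sin (w * (s + L)) = sin (w * s).
Proof. by rewrite mulrDr wL (_ : 2 * pi = pi *+ 2) ?sinD2pi // mulr_natl. Qed.

Let cosL : cos (w * L) = cos (w * 0).
Proof. by rewrite -{1}(add0r L) cos_periodic. Qed.

Let sinL : sin (w * L) = sin (w * 0).
Proof. by rewrite -{1}(add0r L) sin_periodic. Qed.

Lemma itg_cos : itg 0 L (fun s => cos (w * s)) = 0.
Proof.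
apply: (@itg_der_periodic _ (fun s => w^-1 * sin (w * s))) => //; first by cont.
  by move=> s; der; field.
by rewrite sinL.
Qed.

Lemma itg_sin : itg 0 L (fun s => sin (w * s)) = 0.
Proof.
apply: (@itg_der_periodic _ (fun s => - w^-1 * cos (w * s))) => //; first by cont.
  by move=> s; der; field.
by rewrite cosL.
Qed.

Lemma itg_cos2 : itg 0 L (fun s => cos (w * s) ^+ 2) = L / 2.
Proof.
pose F s := s / 2 + (2 * w)^-1 * (sin (w * s) * cos (w * s)).
transitivity (F L - F 0); last by rewrite /F sinL cosL; field.
apply: itg_FTC => //; first by cont.
move=> s _; rewrite /F; der.
transitivity (1 / 2 + (cos (w * s) ^+ 2 - sin (w * s) ^+ 2) / 2); first by field.
by have := cos2Dsin2 (w * s); lra.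
Qed.

Lemma itg_sin2 : itg 0 L (fun s => sin (w * s) ^+ 2) = L / 2.
Proof.
rewrite (@itg_lcomb _ [:: (1, fun=> 1); (- 1, fun s => cos (w * s) ^+ 2)]) /=.
- by rewrite itg_cst // itg_cos2; field.
- by conts.
- by move=> s; rewrite sin2cos2; ring.
Qed.

Lemma itg_sincos : itg 0 L (fun s => sin (w * s) * cos (w * s)) = 0.
Proof.
apply: (@itg_der_periodic _ (fun s => (2 * w)^-1 * sin (w * s) ^+ 2)) => //.
- by cont.
- by move=> s; der; field.
- by rewrite sinL.
Qed.

(** The coefficients are arbitrary, because the formula serves both for the Fourier projection and
    for an interpolating combination. *)
Lemma itg_sub_trig_sqr f a b : continuous f -> itg 0 L (fun s =>
    (f s - (a * cos (w * s) + b * sin (w * s))) ^+ 2) =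
  itg 0 L (fun s => f s ^+ 2)
  - 2 * a * itg 0 L (fun s => f s * cos (w * s))
  - 2 * b * itg 0 L (fun s => f s * sin (w * s)) + (a ^+ 2 + b ^+ 2) * (L / 2).
Proof.
move=> cf.
rewrite (@itg_lcomb _ [:: (1, fun s => f s ^+ 2);
  (- 2 * a, fun s => f s * cos (w * s)); (- 2 * b, fun s => f s * sin (w * s));
  (a ^+ 2, fun s => cos (w * s) ^+ 2); (b ^+ 2, fun s => sin (w * s) ^+ 2);
  (2 * a * b, fun s => sin (w * s) * cos (w * s))]) /=.
- by rewrite itg_cos2 itg_sin2 itg_sincos; ring.
- by conts.
- by move=> s; ring.
Qed.

Section Function.
Variables f f1 : R -> R.
Hypotheses (cf1 : continuous f1) (df : forall s, has_der s f (f1 s)).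
Hypothesis fL : forall s, f (s + L) = f s.

Let cf : continuous f. Proof. exact: der_cont df. Qed.

Let fL0 : f L = f 0. Proof. by rewrite -[LHS]fL -{1}(add0r L) !fL. Qed.

Lemma itg_der_cos : itg 0 L (fun s => f1 s * cos (w * s)) =
  w * itg 0 L (fun s => f s * sin (w * s)).
Proof.
have := @itg_der_periodic _ (fun s => f s * cos (w * s))
  (fun s => f1 s * cos (w * s) - w * (f s * sin (w * s))) L L0'.
rewrite fL0 cosL => E; have {E} := E _ _ erefl.
rewrite (@itg_lcomb _ [:: (1, fun s => f1 s * cos (w * s));
  (- w, fun s => f s * sin (w * s))]) /=.
- move=> E; apply/eqP; rewrite -subr_eq0; apply/eqP.
  by rewrite -[RHS]E; [ring|cont|move=> s; der; ring].
- by conts.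
- by move=> s; ring.
Qed.

Lemma itg_der_sin : itg 0 L (fun s => f1 s * sin (w * s)) =
  - w * itg 0 L (fun s => f s * cos (w * s)).
Proof.
have := @itg_der_periodic _ (fun s => f s * sin (w * s))
  (fun s => f1 s * sin (w * s) + w * (f s * cos (w * s))) L L0'.
rewrite fL0 sinL => E; have {E} := E _ _ erefl.
rewrite (@itg_lcomb _ [:: (1, fun s => f1 s * sin (w * s));
  (w, fun s => f s * cos (w * s))]) /=.
- move=> E; apply/eqP; rewrite -subr_eq0; apply/eqP.
  by rewrite -[RHS]E; [ring|cont|move=> s; der; ring].
- by conts.
- by move=> s; ring.
Qed.

(* Four equidistant points: writing f as even plus odd part under the half-period
   shift, the intermediate value theorem gives a point s0 at which f minus a
   combination of 1, cos, sin vanishes at s0 + k L / 4 for all k. *)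
Lemma four_point_interpolation : exists s0 a b c, [/\ 0 <= s0, s0 <= L / 4 &
  forall k, k \in [:: 0; 1; 2; 3] -> let s := s0 + k * (L / 4) in
    f s = a + (b * cos (w * s) + c * sin (w * s))].
Proof.
pose q := L / 4; have q0 : 0 <= q by rewrite /q divr_ge0.
(* [D s = 0] says that both antipodal pairs have the same mean, which becomes the constant [a]. A
   shift by [q] swaps the pairs, so [D] changes sign on [[0, q]]. *)
pose D s := f s + f (s + 2 * q) - (f (s + q) + f (s + 3 * q)).
have cD : continuous D.
  have ct k : continuous (fun s => f (s + k)) by apply: cont_comp => //; cont.
  have c1 := ct q; have c2 := ct (2 * q); have c3 := ct (3 * q).
  by rewrite /D; cont.
have Dq : D q = - D 0.
  rewrite /D !add0r (_ : q + q = 2 * q); last by ring.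
  rewrite (_ : q + 2 * q = 3 * q); last by ring.
  rewrite (_ : q + 3 * q = L); last by rewrite /q; field.
  by rewrite fL0; ring.
have [|s0 s0q Ds0] := IVT q0 (continuous_subspaceT cD) (v := 0).
  rewrite Dq ge_min le_max oppr_ge0 oppr_le0.
  by case: (leP (D 0) 0) => [//|/ltW ->]; rewrite ?orbT.
pose od s := (f s - f (s + 2 * q)) / 2.
pose C := cos (w * s0); pose S := sin (w * s0).
have CS : C ^+ 2 + S ^+ 2 = 1 by exact: cos2Dsin2.
pose a := (f s0 + f (s0 + 2 * q)) / 2.
(* The odd parts at [s0] and [s0 + q], rotated by the angle [w * s0], so that the combination takes
   these two values there; the other two points follow by the sign change under half a period. *)
pose b := od s0 * C - od (s0 + q) * S; pose c := od s0 * S + od (s0 + q) * C.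
have wq : w * q = pi / 2 by rewrite /q mulrA wL; field.
have wE k : w * (s0 + k * q) = w * s0 + k * (pi / 2).
  by rewrite mulrDr mulrCA wq.
have od3 : f (s0 + 3 * q) = f (s0 + q + 2 * q) by congr f; ring.
have e1 : b * C + c * S = od s0.
  by rewrite -[RHS]mulr1 -CS /b /c; ring.
have e2 : - b * S + c * C = od (s0 + q).
  by rewrite -[RHS]mulr1 -CS /b /c; ring.
move: Ds0; rewrite /D => Ds0.
move: s0q; rewrite in_itv /= => /andP[s00 s0q].
exists s0, a, b, c; split => // k; rewrite !inE => /or4P[] /eqP -> /=.
- by rewrite mul0r addr0 -/C -/S e1 /a /od; field.
- rewrite -/q wE !mul1r cosDpihalf sinDpihalf -/C -/S.
  have -> : b * - S + c * C = od (s0 + q) by rewrite -e2; ring.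
  rewrite /a /od -od3; lra.
- rewrite -/q wE (_ : 2 * (pi / 2) = pi); last by field.
  rewrite cosDpi sinDpi -/C -/S.
  have -> : b * - C + c * - S = - od s0 by rewrite -e1; ring.
  rewrite /a /od; lra.
- rewrite -/q wE (_ : _ + 3 * (pi / 2) = w * s0 + pi + pi / 2); last by field.
  rewrite cosDpihalf sinDpihalf cosDpi sinDpi -/C -/S.
  have -> : b * - - S + c * - C = - od (s0 + q) by rewrite -e2; ring.
  rewrite /a /od -od3; lra.
Qed.

(** Between zeros a quarter period apart the Dirichlet constant is [(pi / (L / 4))^2 = (2 w)^2],
    exactly the one wanted; hence four interpolation points. *)
Lemma wirtinger_second_mode : itg 0 L f = 0 ->
  itg 0 L (fun s => f s * cos (w * s)) = 0 ->
  itg 0 L (fun s => f s * sin (w * s)) = 0 ->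
  4 * w ^+ 2 * itg 0 L (fun s => f s ^+ 2) <= itg 0 L (fun s => f1 s ^+ 2).
Proof.
move=> If Ifc Ifs; have Lp := L0.
have [s0 [a [b [c [s00 s0q fE]]]]] := four_point_interpolation.
pose h s := f s - (a + (b * cos (w * s) + c * sin (w * s))).
pose h1 s := f1 s - (c * w * cos (w * s) + - (b * w) * sin (w * s)).
have dh s : has_der s h (h1 s) by rewrite /h /h1; der; ring.
have ch : continuous h := der_cont dh.
have ch1 : continuous h1 by rewrite /h1; cont.
have hL s : h (s + L) = h s by rewrite /h fL cos_periodic sin_periodic.
have f1L := der_periodic df fL.
have h1L s : h1 (s + L) = h1 s by rewrite /h1 f1L cos_periodic sin_periodic.
pose p k := s0 + k * (L / 4).
have hk k : k \in [:: 0; 1; 2; 3] -> h (p k) = 0.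
  by move=> /fE /= fp; rewrite /h /p fp subrr.
have hp k : k \in [:: 0; 1; 2; 3; 4] -> h (p k) = 0.
  rewrite -[[:: 0; 1; 2; 3; 4]]/([:: 0; 1; 2; 3] ++ [:: 4]) mem_cat.
  move=> /orP[/hk//|]; rewrite inE => /eqP ->.
  have <- : p 0 + L = p 4 by rewrite /p; field.
  by rewrite hL hk // inE eqxx.
have step k : k \in [:: 0; 1; 2; 3; 4] -> k + 1 \in [:: 0; 1; 2; 3; 4] ->
    (2 * w) ^+ 2 * itg (p k) (p (k + 1)) (fun s => h s ^+ 2) <=
    itg (p k) (p (k + 1)) (fun s => h1 s ^+ 2).
  move=> k4 k14; apply: dirichlet_wirtinger => //.
  - by rewrite /p ltrD2l ltr_pM2r ?ltrDl //; lra.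
  - exact: hp.
  - exact: hp.
  - by rewrite mulr_ge0 // ltW // w_gt0.
  - have -> : 2 * w * (p (k + 1) - p k) = w * L / 2 by rewrite /p; field.
    by rewrite wL mulrAC mulfV ?mul1r.
have i1 : (0 : R) + 1 = 1 by ring.
have i2 : (1 : R) + 1 = 2 by ring.
have i3 : (2 : R) + 1 = 3 by ring.
have i4 : (3 : R) + 1 = 4 by ring.
have := step 0; have := step 1; have := step 2; have := step 3.
rewrite i1 i2 i3 i4 !inE !eqxx !orbT => /(_ isT isT) s3 /(_ isT isT) s2.
move=> /(_ isT isT) s1 /(_ isT isT) s0'.
have p4 : p 4 = p 0 + L by rewrite /p; field.
have p0 : 0 <= p 0 <= L by rewrite /p; apply/andP; split; lra.
have [p01 p12 p23 p34] : [/\ p 0 <= p 1, p 1 <= p 2, p 2 <= p 3 & p 3 <= p 4].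
  by rewrite /p; split; lra.
have split4 g : continuous g -> (forall s, g (s + L) = g s) -> itg 0 L g =
    itg (p 0) (p 1) g + (itg (p 1) (p 2) g + (itg (p 2) (p 3) g + itg (p 3) (p 4) g)).
  move=> cg gL; have /andP[p00 p0L] := p0.
  rewrite -(itg_periodic p00 p0L cg gL) -p4.
  rewrite (itg_chasles p01 (le_trans p12 (le_trans p23 p34)) cg).
  by rewrite (itg_chasles p12 (le_trans p23 p34) cg) (itg_chasles p23 p34 cg).
clearbody p.
have : 4 * w ^+ 2 * itg 0 L (fun s => h s ^+ 2) <= itg 0 L (fun s => h1 s ^+ 2).
  have q1 : continuous (fun s => h s ^+ 2) by cont.
  have q2 : continuous (fun s => h1 s ^+ 2) by cont.
  rewrite (split4 _ q1); last by move=> s; rewrite hL.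
  rewrite (split4 _ q2); last by move=> s; rewrite h1L.
  move: s0' s1 s2 s3; have -> : (2 * w) ^+ 2 = 4 * w ^+ 2 by ring.
  by rewrite !mulrDr => ? ? ? ?; do !apply: lerD.
(* By orthogonality the correction only adds its own squares. It adds
   [4 w^2 (L a^2 + (b^2 + c^2) L / 2)] to the smaller side and just [w^2 (b^2 + c^2) L / 2] to the
   larger one, so the inequality for [h] implies that for [f]. *)
have -> : itg 0 L (fun s => h s ^+ 2) =
    itg 0 L (fun s => f s ^+ 2) + (L * a ^+ 2 + (b ^+ 2 + c ^+ 2) * (L / 2)).
  rewrite (@itg_lcomb _ [:: (1, fun s => (f s - (b * cos (w * s) + c * sin (w * s))) ^+ 2);
    (- 2 * a, f); (2 * a * b, fun s => cos (w * s)); (2 * a * c, fun s => sin (w * s));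
    (a ^+ 2, fun=> 1)]) /=.
  - by rewrite (itg_sub_trig_sqr _ _ cf) If Ifc Ifs itg_cst // itg_cos itg_sin; ring.
  - by conts.
  - by move=> s; rewrite /h; ring.
have -> : itg 0 L (fun s => h1 s ^+ 2) =
    itg 0 L (fun s => f1 s ^+ 2) + (b ^+ 2 + c ^+ 2) * w ^+ 2 * (L / 2).
  by rewrite (itg_sub_trig_sqr _ _ cf1) itg_der_cos itg_der_sin Ifc Ifs; ring.
have : 0 <= w ^+ 2 * (L * a ^+ 2).
  by rewrite mulr_ge0 ?sqr_ge0 // mulr_ge0 ?sqr_ge0.
have : 0 <= w ^+ 2 * ((b ^+ 2 + c ^+ 2) * (L / 2)).
  by rewrite mulr_ge0 ?sqr_ge0 // mulr_ge0 ?addr_ge0 ?sqr_ge0 // divr_ge0.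
lra.
Qed.

End Function.

End Modes.

(** * The two energy inequalities for one coordinate *)

Section SecondOrder.
Variable R : realType.
Variables (L w : R) (f f1 f2 : R -> R).
Hypotheses (L0 : 0 < L) (wL : w * L = 2 * pi).
Hypotheses (cf2 : continuous f2) (df : forall s, has_der s f (f1 s)).
Hypotheses (df1 : forall s, has_der s f1 (f2 s)).
Hypotheses (fL : forall s, f (s + L) = f s) (If : itg 0 L f = 0).

Let cf1 : continuous f1. Proof. exact: der_cont df1. Qed.
Let cf : continuous f. Proof. exact: der_cont df. Qed.
Let f1L s : f1 (s + L) = f1 s. Proof. exact: der_periodic df fL s. Qed.
Let w0 := w_gt0 L0 wL.

(** The first mode has energy [K], [w^2 K], [w^4 K] in [f], [f1], [f2]. It thus cancels from
    Wirtinger's inequality and, as [1 - 5 + 4 = 0], from the quartic form, so that only the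
    remainder [g] matters for both. *)
Lemma first_mode_removal : exists (a b : R) (g g1 g2 : R -> R),
  [/\ forall s, f s = a * cos (w * s) + b * sin (w * s) + g s,
      forall s, has_der s g (g1 s), forall s, has_der s g1 (g2 s),
      continuous g2 & forall s, g (s + L) = g s] /\
  [/\ 4 * w ^+ 2 * itg 0 L (fun s => g s ^+ 2) <= itg 0 L (fun s => g1 s ^+ 2),
      itg 0 L (fun s => g s ^+ 2) =
        itg 0 L (fun s => f s ^+ 2) - (a ^+ 2 + b ^+ 2) * (L / 2),
      itg 0 L (fun s => g1 s ^+ 2) =
        itg 0 L (fun s => f1 s ^+ 2) - w ^+ 2 * ((a ^+ 2 + b ^+ 2) * (L / 2)) &
      itg 0 L (fun s => g2 s ^+ 2) =
        itg 0 L (fun s => f2 s ^+ 2) - w ^+ 4 * ((a ^+ 2 + b ^+ 2) * (L / 2))].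
Proof.
have LN0 : L != 0 by exact: lt0r_neq0.
pose a := 2 / L * itg 0 L (fun s => f s * cos (w * s)).
pose b := 2 / L * itg 0 L (fun s => f s * sin (w * s)).
have Ic : itg 0 L (fun s => f s * cos (w * s)) = a * (L / 2).
  by rewrite /a; field.
have Is : itg 0 L (fun s => f s * sin (w * s)) = b * (L / 2).
  by rewrite /b; field.
clearbody a b.
pose g s := f s - (a * cos (w * s) + b * sin (w * s)).
pose g1 s := f1 s - (b * w * cos (w * s) + - (a * w) * sin (w * s)).
pose g2 s := f2 s - (- (a * w ^+ 2) * cos (w * s) + - (b * w ^+ 2) * sin (w * s)).
have dg s : has_der s g (g1 s) by rewrite /g /g1; der; ring.
have dg1 s : has_der s g1 (g2 s) by rewrite /g1 /g2; der; ring.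
have cg : continuous g := der_cont dg.
have cg1 : continuous g1 := der_cont dg1.
have cg2 : continuous g2 by rewrite /g2; cont.
have gL s : g (s + L) = g s.
  by rewrite /g fL (cos_periodic wL) (sin_periodic wL).
exists a, b, g, g1, g2; split; first by split => // s; rewrite /g; ring.
split.
- apply: (wirtinger_second_mode L0 wL cg1 dg gL).
  + rewrite (@itg_lcomb _ [:: (1, f); (- a, fun s => cos (w * s));
      (- b, fun s => sin (w * s))]) /=.
    * by rewrite If (itg_cos L0 wL) (itg_sin L0 wL); ring.
    * by conts.
    * by move=> s; rewrite /g; ring.
  + rewrite (@itg_lcomb _ [:: (1, fun s => f s * cos (w * s));
      (- a, fun s => cos (w * s) ^+ 2);
      (- b, fun s => sin (w * s) * cos (w * s))]) /=.
    * by rewrite Ic (itg_cos2 L0 wL) (itg_sincos L0 wL); ring.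
    * by conts.
    * by move=> s; rewrite /g; ring.
  + rewrite (@itg_lcomb _ [:: (1, fun s => f s * sin (w * s));
      (- b, fun s => sin (w * s) ^+ 2);
      (- a, fun s => sin (w * s) * cos (w * s))]) /=.
    * by rewrite Is (itg_sin2 L0 wL) (itg_sincos L0 wL); ring.
    * by conts.
    * by move=> s; rewrite /g; ring.
- by rewrite (itg_sub_trig_sqr L0 wL _ _ cf) Ic Is; field.
- rewrite (itg_sub_trig_sqr L0 wL _ _ cf1) (itg_der_cos L0 wL cf1 df fL).
  by rewrite (itg_der_sin L0 wL cf1 df fL) Ic Is; field.
- rewrite (itg_sub_trig_sqr L0 wL _ _ cf2) (itg_der_cos L0 wL cf2 df1 f1L).
  rewrite (itg_der_sin L0 wL cf2 df1 f1L) (itg_der_cos L0 wL cf1 df fL).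
  by rewrite (itg_der_sin L0 wL cf1 df fL) Ic Is; field.
Qed.

Let sqr_eq0 (g : R -> R) : continuous g -> (forall s, g (s + L) = g s) ->
  itg 0 L (fun s => g s ^+ 2) <= 0 -> forall s, g s = 0.
Proof.
move=> cg gL Ig; apply: (periodic_eq0 L0 gL) => s sL.
have cg2 : continuous (fun s => g s ^+ 2) by cont.
have I0 : itg 0 L (fun s => g s ^+ 2) = 0.
  apply/eqP; rewrite eq_le Ig /=.
  by apply: itg_ge0 => t _; exact: sqr_ge0.
apply/eqP; rewrite -sqrf_eq0; apply/eqP.
exact: (@itg_eq0 _ (fun s => g s ^+ 2) 0 L L0 cg2 (fun t _ => sqr_ge0 _) I0).
Qed.

Lemma wirtinger : w ^+ 2 * itg 0 L (fun s => f s ^+ 2) <=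
  itg 0 L (fun s => f1 s ^+ 2).
Proof.
have [a [b [g [g1 [g2 [_ [W G0 G1 _]]]]]]] := first_mode_removal.
have : 0 <= w ^+ 2 * itg 0 L (fun s => g s ^+ 2).
  by rewrite mulr_ge0 ?sqr_ge0 //; apply: itg_ge0 => s _; exact: sqr_ge0.
by move: W; rewrite -!mulrA G0 G1 !mulrBr; lra.
Qed.

(** Equality passes to [g], where the stronger constant [4 w^2] leaves [3 w^2] times the integral of
    [g^2] nonpositive. *)
Lemma wirtinger_eq : w ^+ 2 * itg 0 L (fun s => f s ^+ 2) =
    itg 0 L (fun s => f1 s ^+ 2) ->
  exists a b, forall s, f s = a * cos (w * s) + b * sin (w * s).
Proof.
have [a [b [g [g1 [g2 [[fE dg dg1 cg2 gL] [W G0 G1 _]]]]]]] := first_mode_removal.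
move=> E; exists a, b => s; rewrite fE (@sqr_eq0 g) ?addr0 //.
  exact: der_cont dg.
rewrite -(pmulr_rle0 _ (exprn_gt0 2 w0)).
by move: W; rewrite -!mulrA G0 G1 !mulrBr; lra.
Qed.

(** After integration by parts the right side exceeds the left by [3 w^2] times the gap in the
    inequality for [g]. The square on the left settles the equality case too: it vanishes only if
    [g'' = - (2 w)^2 g], a pure second mode. *)
Lemma quartic_wirtinger_split : exists (a b : R) (g g1 g2 : R -> R),
  [/\ forall s, f s = a * cos (w * s) + b * sin (w * s) + g s,
      forall s, has_der s g (g1 s), forall s, has_der s g1 (g2 s),
      continuous g2 & forall s, g (s + L) = g s] /\
  itg 0 L (fun s => (g2 s + 4 * w ^+ 2 * g s) ^+ 2) <=
    itg 0 L (fun s => f2 s ^+ 2) - 5 * w ^+ 2 * itg 0 L (fun s => f1 s ^+ 2)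
    + 4 * w ^+ 4 * itg 0 L (fun s => f s ^+ 2).
Proof.
have [a [b [g [g1 [g2 [H [W G0 G1 G2]]]]]]] := first_mode_removal.
exists a, b, g, g1, g2; split => //; have [_ dg dg1 cg2 gL] := H.
have cg : continuous g := der_cont dg.
have cg1 : continuous g1 := der_cont dg1.
have g1L := der_periodic dg gL.
have Igg2 : itg 0 L (fun s => g s * g2 s) = - itg 0 L (fun s => g1 s ^+ 2).
  have : itg 0 L (fun s => g1 s ^+ 2 + g s * g2 s) = 0.
    apply: (@itg_der_periodic _ (fun s => g s * g1 s)) => //; first exact: ltW.
    - by cont.
    - by move=> s; der; ring.
    - by rewrite -{1 2}(add0r L) gL g1L.
  by rewrite itgD; [lra|cont|cont].
rewrite (@itg_lcomb _ [:: (1, fun s => g2 s ^+ 2);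
  (8 * w ^+ 2, fun s => g s * g2 s); (16 * w ^+ 4, fun s => g s ^+ 2)]) /=.
- rewrite Igg2.
  have : w ^+ 2 * (4 * w ^+ 2 * itg 0 L (fun s => g s ^+ 2)) <=
      w ^+ 2 * itg 0 L (fun s => g1 s ^+ 2) by rewrite ler_wpM2l ?sqr_ge0.
  have -> : w ^+ 2 * (4 * w ^+ 2 * itg 0 L (fun s => g s ^+ 2)) =
      4 * w ^+ 4 * itg 0 L (fun s => g s ^+ 2) by ring.
  move: G0 G1 G2; set F0 := itg _ _ (fun s => f s ^+ 2).
  set F1 := itg _ _ (fun s => f1 s ^+ 2); set F2 := itg _ _ (fun s => f2 s ^+ 2).
  set K := (_ + _) * _ => -> -> ->.
  have -> : 4 * w ^+ 4 * (F0 - K) = 4 * (w ^+ 4 * F0) - 4 * (w ^+ 4 * K) by ring.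
  have -> : 16 * w ^+ 4 * (F0 - K) = 16 * (w ^+ 4 * F0) - 16 * (w ^+ 4 * K) by ring.
  have -> : w ^+ 2 * (F1 - w ^+ 2 * K) = w ^+ 2 * F1 - w ^+ 4 * K by ring.
  have -> : 8 * w ^+ 2 * - (F1 - w ^+ 2 * K) = - 8 * (w ^+ 2 * F1) + 8 * (w ^+ 4 * K) by ring.
  rewrite -!mulrA; lra.
- by conts.
- by move=> s; ring.
Qed.

Lemma quartic_wirtinger :
  0 <= itg 0 L (fun s => f2 s ^+ 2) - 5 * w ^+ 2 * itg 0 L (fun s => f1 s ^+ 2)
    + 4 * w ^+ 4 * itg 0 L (fun s => f s ^+ 2).
Proof.
have [a [b [g [g1 [g2 [_]]]]]] := quartic_wirtinger_split.
by apply: le_trans; apply: itg_ge0 => s _; exact: sqr_ge0.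
Qed.

Lemma quartic_wirtinger_eq :
  itg 0 L (fun s => f2 s ^+ 2) - 5 * w ^+ 2 * itg 0 L (fun s => f1 s ^+ 2)
    + 4 * w ^+ 4 * itg 0 L (fun s => f s ^+ 2) = 0 ->
  exists a b c d, forall s, f s = a * cos (w * s) + b * sin (w * s) +
    (c * cos (2 * w * s) + d * sin (2 * w * s)).
Proof.
have [a [b [g [g1 [g2 [[fE dg dg1 cg2 gL] Q]]]]]] := quartic_wirtinger_split.
move=> E; rewrite E in Q.
have cg : continuous g := der_cont dg.
have g2L := der_periodic dg1 (der_periodic dg gL).
have gE s : g2 s = - (2 * w) ^+ 2 * g s.
  apply/eqP; rewrite -subr_eq0; apply/eqP; rewrite -[RHS](@sqr_eq0 _ _ _ Q s).
  - by ring.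
  - by cont.
  - by move=> t; rewrite gL g2L.
have k0 : 2 * w != 0 by rewrite mulf_neq0 // lt0r_neq0.
exists a, b, (g 0), (g1 0 / (2 * w)) => s.
by rewrite fE (harmonic_ode k0 dg dg1 gE).
Qed.

End SecondOrder.

(** * Fubini in space *)

Section IndicatorIntegral.
Local Open Scope ereal_scope.
Context d1 (T1 : measurableType d1) (R : realType).
Variable m1 : {sigma_finite_measure set T1 -> \bar R}.

Lemma integral_indic_cst (A : set T1) (c : R) : measurable A -> (0 <= c)%R ->
  \int[m1]_t (c * \1_A t)%:E = c%:E * m1 A.
Proof.
move=> mA c0; rewrite -[A in RHS]setIT -integral_indic // -ge0_integralZl //.
by apply/measurable_EFinP; exact: measurable_indic.
Qed.

Lemma integral_indic_cst_lty (A : set T1) (c : R) : measurable A -> (0 <= c)%R ->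
  m1 A < +oo -> \int[m1]_t (c * \1_A t)%:E < +oo.
Proof. by move=> mA c0 Aoo; rewrite integral_indic_cst // lte_mul_pinfty. Qed.

Lemma measurable_cst_indic (A : set T1) (c : R) : measurable A ->
  measurable_fun setT (fun t => (c * \1_A t)%:E).
Proof.
by move=> mA; apply/measurable_EFinP; apply: measurable_funM => //.
Qed.

End IndicatorIntegral.

Section ProductIntegrable.
Local Open Scope ereal_scope.
Context d1 d2 (T1 : measurableType d1) (T2 : measurableType d2) (R : realType).
Variable m1 : {sigma_finite_measure set T1 -> \bar R}.
Variable m2 : {sigma_finite_measure set T2 -> \bar R}.
Variables (F : T1 * T2 -> R) (c : R).
Hypotheses (mF : measurable_fun setT F) (c0 : (0 <= c)%R).

Let mFe : measurable_fun setT (abse \o (EFin \o F)).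
Proof. by apply: measurableT_comp => //; exact/measurable_EFinP. Qed.

(** Tonelli with the inner integral bounded uniformly. Both orders are stated because each half of
    the winding kernel has such a bound in one direction only. *)
Lemma prod_integrable1 (A : set T1) : measurable A -> m1 A < +oo ->
  (forall u, \int[m2]_v `|(F (u, v))%:E| <= (c * \1_A u)%:E) ->
  (m1 \x m2).-integrable setT (EFin \o F).
Proof.
move=> mA Aoo Fc; apply/integrable12ltyP; first exact/measurable_EFinP.
apply: le_lt_trans (integral_indic_cst_lty mA c0 Aoo).
apply: ge0_le_integral; first exact: measurableT.
- by move=> u _ /=; apply: integral_ge0 => v _; rewrite ?lee_fin ?normr_ge0 ?abse_ge0.
- by apply: (measurable_fun_fubini_tonelli_F (abse \o (EFin \o F))) => // ?; exact: abse_ge0.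
- exact: measurable_cst_indic.
- by move=> u _; exact: Fc.
Qed.

Lemma prod_integrable2 (A : set T2) : measurable A -> m2 A < +oo ->
  (forall v, \int[m1]_u `|(F (u, v))%:E| <= (c * \1_A v)%:E) ->
  (m1 \x m2).-integrable setT (EFin \o F).
Proof.
move=> mA Aoo Fc; apply/integrable21ltyP; first exact/measurable_EFinP.
apply: le_lt_trans (integral_indic_cst_lty mA c0 Aoo).
apply: ge0_le_integral; first exact: measurableT.
- by move=> u _ /=; apply: integral_ge0 => v _; rewrite ?lee_fin ?normr_ge0 ?abse_ge0.
- by apply: (measurable_fun_fubini_tonelli_G (abse \o (EFin \o F))) => // ?; exact: abse_ge0.
- exact: measurable_cst_indic.
- by move=> u _; exact: Fc.
Qed.

Lemma prod_integral_le1 (A : set T1) : measurable A ->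
  (forall u, \int[m2]_v `|(F (u, v))%:E| <= (c * \1_A u)%:E) ->
  \int[m1 \x m2]_p `|(F p)%:E| <= c%:E * m1 A.
Proof.
move=> mA Fc; rewrite -integral_indic_cst //.
rewrite (fubini_tonelli1 (abse \o (EFin \o F))) //; last by move=> ?; exact: abse_ge0.
apply: ge0_le_integral; first exact: measurableT.
- by move=> u _ /=; apply: integral_ge0 => v _; rewrite ?lee_fin ?normr_ge0 ?abse_ge0.
- by apply: (measurable_fun_fubini_tonelli_F (abse \o (EFin \o F))) => // ?; exact: abse_ge0.
- exact: measurable_cst_indic.
- by move=> u _; exact: Fc.
Qed.

Lemma prod_integral_le2 (A : set T2) : measurable A ->
  (forall v, \int[m1]_u `|(F (u, v))%:E| <= (c * \1_A v)%:E) ->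
  \int[m1 \x m2]_p `|(F p)%:E| <= c%:E * m2 A.
Proof.
move=> mA Fc; rewrite -integral_indic_cst //.
rewrite (fubini_tonelli2 (abse \o (EFin \o F))) //; last by move=> ?; exact: abse_ge0.
apply: ge0_le_integral; first exact: measurableT.
- by move=> u _ /=; apply: integral_ge0 => v _; rewrite ?lee_fin ?normr_ge0 ?abse_ge0.
- by apply: (measurable_fun_fubini_tonelli_G (abse \o (EFin \o F))) => // ?; exact: abse_ge0.
- exact: measurable_cst_indic.
- by move=> u _; exact: Fc.
Qed.

End ProductIntegrable.

Lemma integrable_fubini_G d1 d2 (T1 : measurableType d1) (T2 : measurableType d2)
    (R : realType) (m1 : {sigma_finite_measure set T1 -> \bar R})
    (m2 : {sigma_finite_measure set T2 -> \bar R}) (f : T1 * T2 -> \bar R) :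
  ((m1 \x m2).-integrable setT f -> m2.-integrable setT (fubini_G m1 f))%E.
Proof.
move=> imf; have mf := measurable_int _ imf; apply/integrableP.
split; first exact: (measurable_fubini_G imf).
apply: le_lt_trans ((@integrable21ltyP _ _ _ _ _ m1 m2 f mf).1 imf).
have mabs : measurable_fun setT (abse \o f) by exact: measurableT_comp.
apply: ge0_le_integral; first exact: measurableT.
- by move=> v _; exact: abse_ge0.
- by apply: measurableT_comp => //; exact: (measurable_fubini_G imf).
- by apply: (measurable_fun_fubini_tonelli_G (abse \o f)) => // ?; exact: abse_ge0.
- move=> v _; apply: le_abse_integral => //.
  exact: (measurableT_comp mf (pair2_measurable v)).
Qed.

Section Lebesgue2.
Local Open Scope ereal_scope.
Variable R : realType.
Notation mu := (@lebesgue_measure R).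
Notation T := (measurableTypeR R).

(* Planar Lebesgue measure under its own name, so that the sigma-finiteness
   needed for Fubini on (R * R) * R can be found by canonical structures. *)
Definition lebesgue2 : set (T * T) -> \bar R := mu \x mu.

HB.instance Definition _ := Measure.on lebesgue2.

Let lebesgue2_sigma_finite : sigma_finite setT lebesgue2.
Proof.
have /sigma_finiteP[F [TF ndF Foo]] := sigma_finiteT mu.
exists (fun n => F n `*` F n) => [|k]; last first.
  have [mF Fk] := Foo k; split; first exact: measurableX.
  by rewrite /lebesgue2 product_measure1E // lte_mul_pinfty // ge0_fin_numE.
apply/esym; rewrite -subTset => -[u v] _.
have [[i _ Fi] [j _ Fj]] : (\bigcup_i F i) u /\ (\bigcup_i F i) v by rewrite -TF.
exists (maxn i j) => //; split => /=.
  by move: Fi; apply/subsetPset/ndF/leq_maxl.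
by move: Fj; apply/subsetPset/ndF/leq_maxr.
Qed.

HB.instance Definition _ :=
  Measure_isSigmaFinite.Build _ _ _ lebesgue2 lebesgue2_sigma_finite.

Variables (F : (T * T) * T -> R) (c : R) (B : set T).
Hypotheses (mF : measurable_fun setT F) (c0 : (0 <= c)%R).
Hypotheses (mB : measurable B) (Boo : mu B < +oo).

Lemma measurable_slice s : measurable_fun setT (fun p : T * T => F (p, s)).
Proof. by apply: measurableT_comp => //; exact: pair2_measurable. Qed.

(** The integrand is unbounded near the curve; the innermost integral alone absorbs the singularity,
    and what is left lives on the finite rectangle [A] times [B]. *)
Lemma space_integrable1 (A : set T) : measurable A -> mu A < +oo ->
  (forall u s, \int[mu]_v `|(F (u, v, s))%:E| <= (c * \1_A u * \1_B s)%:E) ->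
  (lebesgue2 \x mu).-integrable setT (EFin \o F).
Proof.
move=> mA Aoo Fc; have cA : (0 <= c * fine (mu A))%R by rewrite mulr_ge0 ?fine_ge0.
apply: (@prod_integrable2 _ _ _ _ R lebesgue2 mu F _ mF cA B mB Boo) => s.
have cB : (0 <= c * \1_B s)%R by rewrite mulr_ge0.
apply: (@le_trans _ _ ((c * \1_B s)%:E * mu A)).
  apply: (@prod_integral_le1 _ _ _ _ _ mu mu _ _ (measurable_slice s) cB A mA) => u.
  by rewrite mulrAC; exact: Fc.
by rewrite -(@fineK _ (mu A)) ?ge0_fin_numE // -EFinM lee_fin mulrAC.
Qed.

Lemma space_integrable2 (A : set T) : measurable A -> mu A < +oo ->
  (forall v s, \int[mu]_u `|(F (u, v, s))%:E| <= (c * \1_A v * \1_B s)%:E) ->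
  (lebesgue2 \x mu).-integrable setT (EFin \o F).
Proof.
move=> mA Aoo Fc; have cA : (0 <= c * fine (mu A))%R by rewrite mulr_ge0 ?fine_ge0.
apply: (@prod_integrable2 _ _ _ _ R lebesgue2 mu F _ mF cA B mB Boo) => s.
have cB : (0 <= c * \1_B s)%R by rewrite mulr_ge0.
apply: (@le_trans _ _ ((c * \1_B s)%:E * mu A)).
  apply: (@prod_integral_le2 _ _ _ _ _ mu mu _ _ (measurable_slice s) cB A mA) => u.
  by rewrite mulrAC; exact: Fc.
by rewrite -(@fineK _ (mu A)) ?ge0_fin_numE // -EFinM lee_fin mulrAC.
Qed.

End Lebesgue2.

(** * The winding kernel along a horizontal line *)

Section KernelBounds.
Variable R : realType.
Implicit Types (a b c d x y u v z M U : R).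

Lemma has_der_atan (g : R -> R) s b : has_der s g b ->
  has_der s (fun t => atan (g t)) ((1 + g s ^+ 2)^-1 * b).
Proof. by apply: der_comp; exact: is_derive1_atan. Qed.

Lemma has_der_ln (g : R -> R) s b : 0 < g s -> has_der s g b ->
  has_der s (fun t => ln (g t)) ((g s)^-1 * b).
Proof. by move=> g0; apply: der_comp; exact: is_derive1_ln. Qed.

Lemma itg_atan a b y c : c != 0 -> a <= b ->
  itg a b (fun t => c / (c ^+ 2 + (y - t) ^+ 2)) =
  atan ((b - y) / c) - atan ((a - y) / c).
Proof.
move=> c0 ab; have N0 t : c ^+ 2 + (y - t) ^+ 2 != 0.
  by rewrite lt0r_neq0 // ltr_wpDr ?sqr_ge0 // exprn_even_gt0.
apply: (@itg_FTC _ _ (fun t => atan ((t - y) / c))) => //.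
  apply: contM; first exact: cont_cst.
  by apply: contV => //; cont.
move=> t _; have d : has_der t (fun t => (t - y) / c) (c^-1) by der; field.
apply: has_der_eq (has_der_atan d) _.
have -> : 1 + ((t - y) / c) ^+ 2 = (c ^+ 2 + (y - t) ^+ 2) / c ^+ 2 by field.
by rewrite invf_div; move: (N0 t) => N0t; field; rewrite c0 N0t.
Qed.

Lemma itg_log a b x d : d != 0 -> a <= b ->
  itg a b (fun u => (x - u) / ((x - u) ^+ 2 + d ^+ 2)) =
  (ln ((x - a) ^+ 2 + d ^+ 2) - ln ((x - b) ^+ 2 + d ^+ 2)) / 2.
Proof.
move=> d0 ab; have P t : 0 < (x - t) ^+ 2 + d ^+ 2.
  by rewrite ltr_wpDl ?sqr_ge0 // exprn_even_gt0.
pose F t := - (ln ((x - t) ^+ 2 + d ^+ 2) / 2).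
transitivity (F b - F a); last by rewrite /F; field.
apply: itg_FTC => //.
  apply: contM; first by cont.
  by apply: contV; [move=> s; rewrite lt0r_neq0|cont].
move=> t _; have d1 : has_der t (fun t => (x - t) ^+ 2 + d ^+ 2) (- 2 * (x - t)).
  by der; ring.
have d2 := @has_der_ln (fun t => (x - t) ^+ 2 + d ^+ 2) t _ (P t) d1; have N := lt0r_neq0 (P t).
by rewrite /F; der; field.
Qed.

Lemma atan_le z : 0 <= z -> atan z <= z.
Proof.
move=> z0; have [| |c _] := @MVT_segment _ (@atan R) (fun t => (1 + t ^+ 2)^-1) 0 z.
- by [].
- by apply: continuous_subspaceT => t; exact: continuous_atan.
rewrite atan0 !subr0 => ->; rewrite ler_piMl // invf_le1 ?ltr_wpDr ?sqr_ge0 //.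
by rewrite lerDl sqr_ge0.
Qed.

Lemma atan_recip z : 0 < z -> pi / 2 - atan z = atan z^-1.
Proof.
move=> z0; have a0 : 0 < atan z by rewrite -atan0 lt_atan.
have [/andP[_ a2] tz] := atan_def z.
rewrite -[LHS]tanK; last by rewrite in_itv /=; apply/andP; split; lra.
rewrite /tan sinB cosB sin_pihalf cos_pihalf !mul0r !mul1r subr0 add0r.
by rewrite -{3}tz /tan invf_div.
Qed.

Lemma atan_near_pihalf z c : 0 < c -> c <= z ->
  pi / 2 - c^-1 <= atan z <= pi / 2.
Proof.
move=> c0 cz; have z0 := lt_le_trans c0 cz.
rewrite (ltW (atan_ltpi2 z)) andbT lerBlDr -lerBlDl atan_recip //.
by apply: le_trans (atan_le _) _; rewrite ?invr_ge0 ?(ltW z0) // lef_pV2.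
Qed.

Lemma ln_dist a b m : 0 < m -> m <= a -> m <= b -> `|ln a - ln b| <= `|a - b| / m.
Proof.
move=> m0; have main c d : m <= c -> m <= d -> ln c - ln d <= `|c - d| / m.
  move=> mc md; have c0 := lt_le_trans m0 mc; have d0 := lt_le_trans m0 md.
  rewrite -ln_div ?posrE //; apply: (@le_trans _ _ (c / d - 1)).
    rewrite -{1}(subrK 1 (c / d)) addrC.
    by apply: le_ln1Dx; rewrite ltrBrDl addrN divr_gt0.
  have -> : c / d - 1 = (c - d) / d by field; lra.
  apply: (@le_trans _ _ (`|c - d| / d)); first by rewrite ler_pM2r ?invr_gt0 // ler_norm.
  by rewrite ler_wpM2l // lef_pV2.
move=> ma mb; rewrite ler_norml main // andbT lerNl opprB distrC.
exact: main.
Qed.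

Section Inner.
Variables (M U x y a b v : R).
Hypotheses (M0 : 0 < M) (MU : 2 * M <= U) (xM : `|x| <= M) (yM : `|y| <= M).
Hypotheses (vM : `|v| <= M) (a1 : `|a| <= 1) (b1 : `|b| <= 1).

(** The winding integrand at the point [(u, v)], with [(x, y)] the curve point, [a] the derivative
    of the second coordinate and [b] that of the first. *)
Let kernel u := ((x - u) * a - (y - v) * b) / ((x - u) ^+ 2 + (y - v) ^+ 2).

Let kernelE : y != v -> itg (- U) U kernel =
  a * ((ln ((x + U) ^+ 2 + (y - v) ^+ 2) - ln ((x - U) ^+ 2 + (y - v) ^+ 2)) / 2)
  - b * (atan ((U - x) / (y - v)) + atan ((U + x) / (y - v))).
Proof.
move=> yv; have d0 : y - v != 0 by rewrite subr_eq0.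
have UU : - U <= U by have := M0; have := MU; lra.
have P t : 0 < (x - t) ^+ 2 + (y - v) ^+ 2.
  by rewrite ltr_wpDl ?sqr_ge0 // exprn_even_gt0.
have N t := lt0r_neq0 (P t).
have N' t : (y - v) ^+ 2 + (x - t) ^+ 2 != 0 by rewrite addrC.
have cV : continuous (fun t => ((x - t) ^+ 2 + (y - v) ^+ 2)^-1).
  by apply: contV => //; cont.
have cV' : continuous (fun t => ((y - v) ^+ 2 + (x - t) ^+ 2)^-1).
  by apply: contV => //; cont.
rewrite (@itg_lcomb _ [:: (a, fun u => (x - u) / ((x - u) ^+ 2 + (y - v) ^+ 2));
   (- b, fun u => (y - v) / ((y - v) ^+ 2 + (x - u) ^+ 2))]) /=.
- rewrite itg_log // itg_atan // opprK.
  have -> : (- U - x) / (y - v) = - ((U + x) / (y - v)) by field.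
  by rewrite atanN; ring.
- by split; [|split]; [apply: contM => //; cont|apply: contM => //; cont|].
- by move=> u; rewrite /kernel [(y - v) ^+ 2 + _]addrC; ring.
Qed.

(** The segment is symmetric, so the logarithms nearly cancel: their arguments differ by [4 x U] and
    are at least [U^2 / 4]. *)
Let log_bound :
  `|a * ((ln ((x + U) ^+ 2 + (y - v) ^+ 2) - ln ((x - U) ^+ 2 + (y - v) ^+ 2)) / 2)|
  <= 8 * M / U.
Proof.
have [U0 xM'] : 0 < U /\ - M <= x <= M.
  by split; [have := M0; have := MU; lra|rewrite -ler_norml].
have m0 : 0 < U ^+ 2 / 4 by rewrite divr_gt0 // exprn_gt0.
have Ux t : U / 2 <= `|t| -> U ^+ 2 / 4 <= t ^+ 2 + (y - v) ^+ 2.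
  move=> Ut; apply: (@le_trans _ _ (t ^+ 2)); last by rewrite lerDl sqr_ge0.
  have -> : U ^+ 2 / 4 = (U / 2) ^+ 2 by field.
  by rewrite -(real_normK (num_real t)) ler_sqr ?nnegrE ?divr_ge0 // ltW.
have e1 : U / 2 <= `|x + U| by rewrite ler_normr; have := MU; lra.
have e2 : U / 2 <= `|x - U| by rewrite ler_normr; have := MU; lra.
have := ln_dist m0 (Ux _ e1) (Ux _ e2).
have -> : (x + U) ^+ 2 + (y - v) ^+ 2 - ((x - U) ^+ 2 + (y - v) ^+ 2) = x * (4 * U) by ring.
set l := ln _ - _ => lE; rewrite !normrM (ger0_norm (_ : 0 <= 2^-1)) //.
have l16 : `|l| <= 16 * M / U.
  apply: le_trans lE _; rewrite normrM (ger0_norm (_ : 0 <= 4 * U)); last by lra.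
  have -> : `|x| * (4 * U) / (U ^+ 2 / 4) = 16 * `|x| / U by field; lra.
  by rewrite ler_pM2r ?invr_gt0 // ler_pM2l.
apply: (@le_trans _ _ (1 * (`|l| / 2))); last by lra.
by rewrite ler_wpM2r // divr_ge0.
Qed.

(** Each argument is at least [U / (2 d)], so each arctangent misses [pi / 2] by at most
    [2 d / U <= 4 M / U]. *)
Let atan_bound d : 0 < d -> d <= 2 * M ->
  pi - 8 * M / U <= atan ((U - x) / d) + atan ((U + x) / d) <= pi.
Proof.
have M0' := M0; have MU' := MU.
have U0 : 0 < U by lra.
have /andP[x1 x2] : - M <= x <= M by rewrite -ler_norml.
move=> d0 dM; have c0 : 0 < U / 2 / d by rewrite !divr_gt0.
have h t : U / 2 <= t -> pi / 2 - 4 * M / U <= atan (t / d) <= pi / 2.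
  move=> Ut; have /andP[h1 h2] : pi / 2 - (U / 2 / d)^-1 <= atan (t / d) <= pi / 2.
    by apply: atan_near_pihalf => //; rewrite ler_pM2r ?invr_gt0.
  rewrite h2 andbT; apply: le_trans h1; rewrite lerD2l lerN2.
  have -> : (U / 2 / d)^-1 = 2 * d / U by field; rewrite !lt0r_neq0.
  by rewrite ler_pM2r ?invr_gt0 //; lra.
have /andP[h1 h2] := h (U - x) ltac:(lra).
have /andP[h3 h4] := h (U + x) ltac:(lra).
by apply/andP; split; lra.
Qed.

(** The sign of [y - v] decides the sign of both arctangents, hence of the term [b * pi] here and in
    the next lemma. Logarithms and arctangents contribute [8 M / U] each to the error. *)
Lemma kernel_itg_below : v < y ->
  - b * pi - 16 * M / U <= itg (- U) U kernel <= - b * pi + 16 * M / U.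
Proof.
move=> vy; rewrite kernelE ?gt_eqF //.
have /andP[l1 l2] : - (8 * M / U) <= a * ((ln ((x + U) ^+ 2 + (y - v) ^+ 2) -
  ln ((x - U) ^+ 2 + (y - v) ^+ 2)) / 2) <= 8 * M / U by rewrite -ler_norml log_bound.
move: yM vM; rewrite !ler_norml => /andP[y1 y2] /andP[v1 v2].
have /andP[] := @atan_bound (y - v) ltac:(lra) ltac:(lra).
set t := atan _ + _; set e := 8 * M / U in l1 l2 * => t1 t2.
have -> : 16 * M / U = 2 * e by rewrite /e; field; have := M0; have := MU; lra.
have /andP[? ?] : - e <= b * (t - pi) <= e.
  rewrite -ler_norml normrM; apply: (@le_trans _ _ (1 * `|t - pi|)).
    by rewrite ler_wpM2r.
  by rewrite mul1r ler_norml; lra.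
by rewrite (_ : b * t = b * pi + b * (t - pi)); [lra|ring].
Qed.

Lemma kernel_itg_above : y < v ->
  b * pi - 16 * M / U <= itg (- U) U kernel <= b * pi + 16 * M / U.
Proof.
move=> vy; rewrite kernelE ?lt_eqF //.
have /andP[l1 l2] : - (8 * M / U) <= a * ((ln ((x + U) ^+ 2 + (y - v) ^+ 2) -
  ln ((x - U) ^+ 2 + (y - v) ^+ 2)) / 2) <= 8 * M / U by rewrite -ler_norml log_bound.
move: yM vM; rewrite !ler_norml => /andP[y1 y2] /andP[v1 v2].
have /andP[] := @atan_bound (v - y) ltac:(lra) ltac:(lra).
have atE r : atan (r / (y - v)) = - atan (r / (v - y)).
  by rewrite -atanN -mulrN -invrN opprB.
rewrite !atE; set t := atan _ + _; set e := 8 * M / U in l1 l2 * => t1 t2.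
have -> : 16 * M / U = 2 * e by rewrite /e; field; have := M0; have := MU; lra.
have /andP[? ?] : - e <= b * (t - pi) <= e.
  rewrite -ler_norml normrM; apply: (@le_trans _ _ (1 * `|t - pi|)).
    by rewrite ler_wpM2r.
  by rewrite mul1r ler_norml; lra.
rewrite -opprD -/t mulrN opprK.
by rewrite (_ : b * t = b * pi + b * (t - pi)); [lra|ring].
Qed.

End Inner.

End KernelBounds.

(** * Winding number and enclosed area *)

Lemma lipschitz1 (R : realType) (f f1 : R -> R) : (forall s, has_der s f (f1 s)) ->
  (forall s, `|f1 s| <= 1) -> forall s t, `|f s - f t| <= `|s - t|.
Proof.
move=> df f11; have main s t : s <= t -> `|f s - f t| <= `|s - t|.
  move=> st; have [||c _ E] := @MVT_segment _ f f1 s t st.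
  - by move=> r _; exact: df.
  - exact: continuous_subspaceT (der_cont df).
  by rewrite distrC E normrM (distrC s) ler_piMl.
move=> s t; have [/main//|/ltW/main] := leP s t.
by rewrite (distrC (f t)) (distrC t).
Qed.

Section OneVariable.
Variable R : realType.
Notation mu := (@lebesgue_measure R).
Notation T := (measurableTypeR R).
Local Open Scope ereal_scope.

Lemma integral_indicM (A : set T) (f : T -> R) : measurable A ->
  \int[mu]_t (\1_A t * f t)%:E = \int[mu]_(t in A) (f t)%:E.
Proof.
move=> mA; rewrite [RHS]integral_mkcond; apply: eq_integral => t _.
by rewrite patchE indicE; case: ifPn => _; rewrite ?mul1r ?mul0r.
Qed.

Lemma itg_EFin (f : R -> R) a b : continuous f ->
  \int[mu]_(t in `[a, b]) (f t)%:E = (itg a b f)%:E.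
Proof.
move=> cf; rewrite /itg /Rintegral fineK //.
exact: (integrable_fin_num _ (cont_itg_integrable a b cf)).
Qed.

(** The integrand is [pi] times a Poisson kernel, whose total mass does not depend on [a]; for
    [a = 0] it vanishes identically. *)
Lemma poisson_le (a c lo hi : R) : (lo <= hi)%R ->
  \int[mu]_t (\1_`[lo, hi] t * (`|a| / (a ^+ 2 + (c - t) ^+ 2)))%:E <= pi%:E.
Proof.
move=> lohi; have [->|a0] := eqVneq a 0%R.
  under eq_integral do rewrite normr0 mul0r mulr0.
  by rewrite integral0 lee_fin pi_ge0.
rewrite integral_indicM // -(real_normK (num_real a)).
have n0 : `|a|%R != 0%R by rewrite normr_eq0.
rewrite itg_EFin; last first.
  apply: contM; first exact: cont_cst.
  apply: contV => [t|]; last by cont.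
  by rewrite lt0r_neq0 // ltr_wpDr ?sqr_ge0 // exprn_gt0 // lt_def n0 normr_ge0.
rewrite itg_atan // lee_fin.
have := atan_ltpi2 ((hi - c) / `|a|)%R; have := atan_gtNpi2 ((lo - c) / `|a|)%R; lra.
Qed.

End OneVariable.

(** Bounds [(r + t) / (r^2 + t^2)] by [2 / N], the decay of the winding kernel at points far away in
    at least one coordinate. *)
Lemma sum_le_sqr (R : realType) (N r t : R) : 0 < N -> 0 <= r -> 0 <= t ->
  N <= r \/ N <= t -> (r + t) * N <= 2 * (r ^+ 2 + t ^+ 2).
Proof.
move=> N0 r0 t0.
wlog rt : r t r0 t0 / t <= r => [W|].
  have [/W|/ltW/W H] := leP t r; first exact.
  by move=> Nq; rewrite addrC [X in _ <= _ * X]addrC; apply: H => //; case: Nq; tauto.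
move=> Nq; have Np : N <= r by case: Nq => //; lra.
apply: (@le_trans _ _ ((2 * r) * r)); last first.
  by rewrite -mulrA -expr2 ler_pM2l // lerDl sqr_ge0.
apply: (@le_trans _ _ ((r + t) * r)); first by rewrite ler_wpM2l // addr_ge0.
by rewrite ler_wpM2r //; lra.
Qed.

Section Winding.
Variable R : realType.
Variables (x y : R -> R) (L : R).
Hypotheses (L0 : 0 < L).
Hypotheses (dx : forall s, has_der s x (derive1 x s)) (dy : forall s, has_der s y (derive1 y s)).
Hypotheses (cx1 : continuous (derive1 x)) (cy1 : continuous (derive1 y)).
Hypotheses (xL : forall s, x (s + L) = x s) (yL : forall s, y (s + L) = y s).
Hypothesis speed : forall s, derive1 x s ^+ 2 + derive1 y s ^+ 2 = 1.

Let C := curve_set x y L.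
Let cx : continuous x. Proof. exact: der_cont dx. Qed.
Let cy : continuous y. Proof. exact: der_cont dy. Qed.

Definition wkernel (p : R * R) s :=
  ((x s - p.1) * derive1 y s - (y s - p.2) * derive1 x s) / sqnorm (x s - p.1) (y s - p.2).

Lemma windingE p : winding x y L p = (2 * pi)^-1 * itg 0 L (wkernel p).
Proof. by []. Qed.

Lemma speed_x s : `|derive1 x s| <= 1.
Proof.
rewrite -(@expr_le1 _ 2) ?normr_ge0 // real_normK ?num_real //.
by have := speed s; have := sqr_ge0 (derive1 y s); lra.
Qed.

Lemma speed_y s : `|derive1 y s| <= 1.
Proof.
rewrite -(@expr_le1 _ 2) ?normr_ge0 // real_normK ?num_real //.
by have := speed s; have := sqr_ge0 (derive1 x s); lra.
Qed.

Lemma curve_point s : C (x s, y s).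
Proof.
have [t tL ft] := periodic_rep s L0; exists t; first by rewrite /= in_itv.
by rewrite -(ft _ x xL) -(ft _ y yL).
Qed.

Lemma curve_dist p : ~ C p ->
  exists2 d : R, 0 < d & forall s, d <= sqnorm (x s - p.1) (y s - p.2).
Proof.
move=> Cp; pose D s := sqnorm (x s - p.1) (y s - p.2).
have cD : continuous D by rewrite /D /sqnorm; cont.
have [c cL Dc] := EVT_min (ltW L0) (continuous_subspaceT cD).
exists (D c) => [|s].
  rewrite lt_def; apply/andP; split; last by rewrite addr_ge0 ?sqr_ge0.
  apply/negP; rewrite /D /sqnorm paddr_eq0 ?sqr_ge0 // !sqrf_eq0 !subr_eq0.
  move=> /andP[/eqP xc /eqP yc]; apply: Cp; exists c; first exact: cL.
  by rewrite xc yc; case: (p).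
have [t tL ft] := periodic_rep s L0.
have DL r : D (r + L) = D r by rewrite /D xL yL.
by rewrite -/(D s) (ft _ D DL); apply: Dc; rewrite in_itv.
Qed.

Lemma wkernel_cont p : ~ C p -> continuous (wkernel p).
Proof.
move=> /curve_dist[d d0 Dd]; rewrite /wkernel; apply: contM; first by cont.
apply: contV => [s|]; last by rewrite /sqnorm; cont.
by rewrite lt0r_neq0 // (lt_le_trans d0).
Qed.

(* The angle subtended at [X s] by p and q is atan (num / den) with den > 0;
   it is periodic and its derivative is the difference of the two kernels. *)
Lemma winding_locally_constant p d q :
  (forall s, d <= sqnorm (x s - p.1) (y s - p.2)) ->
  sqnorm (p.1 - q.1) (p.2 - q.2) < d ->
  ~ C p -> ~ C q /\ winding x y L q = winding x y L p.
Proof.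
move=> Dd qd Cp.
pose den s := (x s - p.1) * (x s - q.1) + (y s - p.2) * (y s - q.2).
pose num s := (x s - p.1) * (y s - q.2) - (y s - p.2) * (x s - q.1).
have den0 s : 0 < den s.
  have : den s = (sqnorm (x s - p.1) (y s - p.2) + sqnorm (x s - q.1) (y s - q.2)
      - sqnorm (p.1 - q.1) (p.2 - q.2)) / 2 by rewrite /den /sqnorm; field.
  have : 0 <= sqnorm (x s - q.1) (y s - q.2) by rewrite addr_ge0 ?sqr_ge0.
  by have := Dd s; lra.
have lagrange s : den s ^+ 2 + num s ^+ 2 =
    sqnorm (x s - p.1) (y s - p.2) * sqnorm (x s - q.1) (y s - q.2).
  by rewrite /den /num /sqnorm; ring.
have N0 s : den s ^+ 2 + num s ^+ 2 != 0.
  by rewrite lt0r_neq0 // ltr_wpDr ?sqr_ge0 // exprn_gt0.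
have Np s : sqnorm (x s - p.1) (y s - p.2) != 0.
  by have := N0 s; rewrite lagrange mulf_eq0 negb_or => /andP[].
have Nq s : sqnorm (x s - q.1) (y s - q.2) != 0.
  by have := N0 s; rewrite lagrange mulf_eq0 negb_or => /andP[].
have Cq : ~ C q.
  move=> [s _ qE]; have := Nq s.
  by rewrite -qE /sqnorm /= !subrr expr0n addr0 eqxx.
split => //; rewrite !windingE; congr (_ * _).
have cp := wkernel_cont Cp; have cq := wkernel_cont Cq.
have dphi s : has_der s (fun t => atan (num t / den t)) (wkernel q s - wkernel p s).
  have d1 : has_der s num (derive1 x s * (y s - q.2) + (x s - p.1) * derive1 y s -
      (derive1 y s * (x s - q.1) + (y s - p.2) * derive1 x s)) by rewrite /num; der; ring.
  have d2 : has_der s den (derive1 x s * (x s - q.1) + (x s - p.1) * derive1 x s +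
      (derive1 y s * (y s - q.2) + (y s - p.2) * derive1 y s)) by rewrite /den; der; ring.
  have dN0 := lt0r_neq0 (den0 s).
  have d3 := derM d1 (derV dN0 d2).
  apply: has_der_eq (has_der_atan d3) _.
  have -> : 1 + (num s / den s) ^+ 2 = (den s ^+ 2 + num s ^+ 2) / den s ^+ 2 by field.
  rewrite lagrange invf_div /wkernel.
  have := Np s; have := Nq s; move: dN0.
  rewrite /num /den /sqnorm => D0 Q0 P0; field.
  by rewrite P0 Q0 D0.
have : itg 0 L (fun s => wkernel q s - wkernel p s) = 0.
  apply: (itg_der_periodic (ltW L0) _ dphi); first by cont.
  by rewrite /num /den -{1 2 3 4 5 6 7 8}(add0r L) !xL !yL.
by rewrite (@itg_lcomb _ [:: (1, wkernel q); (- 1, wkernel p)]) /=;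
  [lra|conts|move=> s; ring].
Qed.

Lemma open_winding (r : R) : open [set q | ~ C q /\ winding x y L q = r].
Proof.
rewrite openE => p [Cp wp]; have [d d0 Dd] := curve_dist Cp.
(* Balls in the product are sup-norm balls: each coordinate contributes at most [e^2 <= e], so the
   squared distance is at most [2 e <= d / 2]. *)
pose e := Num.min 1 (d / 4).
have e0 : 0 < e by rewrite lt_min ltr01 divr_gt0.
have e1 : e <= 1 by rewrite ge_min lexx.
have ed : e <= d / 4 by rewrite ge_min lexx orbT.
apply/nbhs_ballP; exists e => // q [/= q1 q2].
have sq t : `|t| < e -> t ^+ 2 <= e.
  move=> te; rewrite -(real_normK (num_real t)) expr2 -[leRHS]mulr1.
  by apply: ler_pM => //; lra.
have [] := @winding_locally_constant p d q Dd _ Cp; last by rewrite wp.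
have := sq _ q1; have := sq _ q2; rewrite /sqnorm; lra.
Qed.

(** The level sets of the winding number partition the complement of the curve into open sets, and a
    connected component can meet only one of them. *)
Lemma winding_component p q : connected_component (~` C) p q ->
  winding x y L q = winding x y L p.
Proof.
move=> pq; have Cp : ~ C p.
  by move=> Cp; move: pq; rewrite connected_component_out //; apply.
pose w := winding x y L.
have cc := @component_connected _ (~` C) p.
pose B := connected_component (~` C) p `&` [set r | ~ C r /\ w r = w p].
suff BE : B = connected_component (~` C) p.
  by move: pq; rewrite -BE => -[_ [_]].
apply: cc.
- exists p; split => //; exact: connected_component_refl.
- by exists [set r | ~ C r /\ w r = w p] => //; exact: open_winding.
(* Relatively closed: on the component, which avoids the curve, the level set is the complement of
   the union of all the others. *)
- exists (~` \bigcup_(r in [set r | r != w p]) [set q | ~ C q /\ w q = r]).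
    by apply: open_closedC; apply: bigcup_open => r _; exact: open_winding.
  apply/seteqP; split => r [cr].
    move=> [Cr wr]; split => // -[r' /= /eqP r'N [_ wr']]; apply: r'N.
    by rewrite -wr' wr.
  move=> H; split => //; have Cr : ~ C r := connected_component_sub cr.
  split => //; apply: contrapT => wN; apply: H; exists (w r) => //=.
  exact/eqP.
Qed.

Lemma curve_bounded : exists2 M : R, 0 < M & forall s, `|x s| <= M /\ `|y s| <= M.
Proof.
have cD : continuous (fun s => x s ^+ 2 + y s ^+ 2) by cont.
have [c _ Dc] := EVT_max (ltW L0) (continuous_subspaceT cD).
pose D := x c ^+ 2 + y c ^+ 2.
have D0 : 0 <= D by rewrite addr_ge0 ?sqr_ge0.
(* [|r| <= r^2 + 1] turns the bound on squares into one on the coordinates without a square root. *)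
exists (D + 1) => [|s]; first by lra.
have [t tL ft] := periodic_rep s L0.
rewrite (ft _ x xL) (ft _ y yL).
have Dt : x t ^+ 2 + y t ^+ 2 <= D by apply: Dc; rewrite in_itv.
have sq r : r ^+ 2 <= D -> `|r| <= D + 1.
  rewrite -(real_normK (num_real r)) => rD.
  have : 0 <= (`|r| - 1) ^+ 2 by rewrite sqr_ge0.
  rewrite sqrrB1; have := normr_ge0 r; lra.
by split; apply: sq; have := sqr_ge0 (x t); have := sqr_ge0 (y t); lra.
Qed.

Section Bounded.
Variable M : R.
Hypotheses (M0 : 0 < M) (XM : forall s, `|x s| <= M /\ `|y s| <= M).

Lemma far_off_curve q (N : R) : 0 < N -> M + N <= `|q.1| \/ M + N <= `|q.2| ->
  forall s, N <= `|x s - q.1| \/ N <= `|y s - q.2|.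
Proof.
move=> N0 H s; have [xM yM] := XM s; case: H => H; [left|right].
  have := ler_normB (x s) (x s - q.1); rewrite opprB addrC subrK; lra.
have := ler_normB (y s) (y s - q.2); rewrite opprB addrC subrK; lra.
Qed.

Lemma far_not_curve q (N : R) : 0 < N -> M + N <= `|q.1| \/ M + N <= `|q.2| -> ~ C q.
Proof.
move=> N0 /(far_off_curve N0) H [s _ qE]; have := H s.
by rewrite -qE /= !subrr normr0; lra.
Qed.

Lemma winding_far q (N : R) : 0 < N -> M + N <= `|q.1| \/ M + N <= `|q.2| ->
  `|winding x y L q| <= (2 * pi)^-1 * (2 / N * L).
Proof.
move=> N0 H; have Cq := far_not_curve N0 H.
have pi0 : 0 < (2 * pi)^-1 :> R by rewrite invr_gt0 mulr_gt0 // pi_gt0.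
rewrite windingE normrM (gtr0_norm pi0) ler_pM2l //.
rewrite -[X in _ * X]subr0; apply: le_norm_itg (ltW L0) (wkernel_cont Cq) _ => s _.
have Nq := far_off_curve N0 H s.
rewrite /wkernel normrM; set a := x s - q.1 in Nq *; set b := y s - q.2 in Nq *.
have ab0 : 0 < sqnorm a b.
  rewrite /sqnorm -(real_normK (num_real a)) -(real_normK (num_real b)).
  by case: Nq => ?; [rewrite ltr_wpDr|rewrite ltr_wpDl]; rewrite ?sqr_ge0 // exprn_gt0 // (lt_le_trans N0).
rewrite (gtr0_norm (_ : 0 < (sqnorm a b)^-1)) ?invr_gt0 //.
rewrite ler_pdivrMr // mulrAC ler_pdivlMr //.
have h1 : `|a * derive1 y s - b * derive1 x s| <= `|a| + `|b|.
  apply: le_trans (ler_normB _ _) _; rewrite !normrM.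
  apply: lerD; rewrite -[leRHS]mulr1; apply: ler_wpM2l => //.
    exact: speed_y.
  exact: speed_x.
apply: (@le_trans _ _ ((`|a| + `|b|) * N)); first by rewrite ler_pM2r.
rewrite /sqnorm -(real_normK (num_real a)) -(real_normK (num_real b)).
by apply: sum_le_sqr.
Qed.

(** By contraposition: the winding number is constant on the component of [p] and decays far away,
    so a nonzero value confines the component to a bounded region. *)
Lemma winding_not_enclosed p : ~ C p -> ~ enclosed x y L p -> winding x y L p = 0.
Proof.
move=> Cp nE; apply/eqP; rewrite -normr_eq0 eq_le normr_ge0 andbT leNgt.
apply/negP; set w := `|_| => w0.
have pi0 : 0 < pi :> R := pi_gt0 R.
(* Chosen so that the bound of [winding_far] at distance [N] equals [w / 2], which is less than
   [w]. *)
pose N := 2 * L / (pi * w).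
have N0 : 0 < N by rewrite /N divr_gt0 ?mulr_gt0.
apply: nE; split => //; exists (M + N) => q pq.
have wE := winding_component pq.
have H : ~ (M + N <= `|q.1| \/ M + N <= `|q.2|).
  move=> /(winding_far N0); rewrite wE -/w.
  have -> : (2 * pi)^-1 * (2 / N * L) = w / 2.
    rewrite /N; move: (pi : R) pi0 => P P0; field.
    by rewrite !(lt0r_neq0 w0, lt0r_neq0 P0, lt0r_neq0 L0).
  by lra.
by split; apply/ltW; rewrite ltNge; apply/negP => ?; apply: H; [left|right].
Qed.

Lemma ray_not_enclosed p (e : R * R) : e.1 != 0 \/ e.2 != 0 ->
  (forall t, 0 <= t -> ~ C (p.1 + t * e.1, p.2 + t * e.2)) -> ~ enclosed x y L p.
Proof.
move=> e0 Ce [_ [B HB]].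
pose ray (t : R) : R * R := (p.1 + t * e.1, p.2 + t * e.2).
have cr : continuous ray.
  have c1 : continuous (fun t : R => p.1 + t * e.1) by cont.
  have c2 : continuous (fun t : R => p.2 + t * e.2) by cont.
  by move=> t; exact: (cvg_pair (c1 t) (c2 t)).
have conn : connected (ray @` `[0, +oo[).
  apply: connected_continuous_connected; last exact: continuous_subspaceT.
  by apply/connected_intervalP; exact: interval_is_interval.
have sub : ray @` `[0, +oo[ `<=` connected_component (~` C) p.
  apply: connected_component_max => //.
    exists 0; first by rewrite /= in_itv /= lexx.
    by rewrite /ray !mul0r !addr0; case: (p).
  by move=> _ [t + <-]; rewrite /= in_itv /= andbT => /Ce.
have HB' t : 0 <= t -> `|p.1 + t * e.1| <= B /\ `|p.2 + t * e.2| <= B.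
  by move=> t0; apply: (HB (ray t)); apply: sub; exists t => //; rewrite /= in_itv /= t0.
have B0 : 0 <= B by have [/(le_trans (normr_ge0 _))] := HB' 0 (lexx _).
have unb a b : b != 0 -> ~ (forall t, 0 <= t -> `|a + t * b| <= B).
  move=> b0 H; have b1 : 0 < `|b| by rewrite normr_gt0.
  have := H ((B + `|a| + 1) / `|b|); rewrite divr_ge0 ?addr_ge0 // => /(_ isT).
  set t := _ / _; have tb : `|t * b| = B + `|a| + 1.
    by rewrite normrM /t normrM normfV normr_id mulfVK ?gt_eqF // ger0_norm // !addr_ge0.
  have := ler_normB (a + t * b) a; rewrite addrAC subrr add0r tb; lra.
by case: e0 => [/(unb p.1)|/(unb p.2)]; apply => t /HB'[].
Qed.

(** A point outside the square escapes along an axis-parallel ray pointing away from it, which the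
    curve cannot meet. *)
Lemma enclosed_bounded p : enclosed x y L p -> `|p.1| <= M /\ `|p.2| <= M.
Proof.
move=> Ep; have XMx s : - M <= x s <= M by rewrite -ler_norml; have [] := XM s.
have XMy s : - M <= y s <= M by rewrite -ler_norml; have [] := XM s.
have o0 : (1 : R) != 0 := oner_neq0 _.
have N0 : (- 1 : R) != 0 by rewrite oppr_eq0.
have H1 : p.1 <= M.
  rewrite leNgt; apply/negP => pM; apply: (@ray_not_enclosed p (1, 0)) Ep; first by left.
  by move=> t t0 [s _ [xs _]]; have /andP[] := XMx s; rewrite xs /=; lra.
have H2 : - M <= p.1.
  rewrite leNgt; apply/negP => pM; apply: (@ray_not_enclosed p (- 1, 0)) Ep; first by left.
  by move=> t t0 [s _ [xs _]]; have /andP[] := XMx s; rewrite xs /=; lra.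
have H3 : p.2 <= M.
  rewrite leNgt; apply/negP => pM; apply: (@ray_not_enclosed p (0, 1)) Ep; first by right.
  by move=> t t0 [s _ [_ ys]]; have /andP[] := XMy s; rewrite ys /=; lra.
have H4 : - M <= p.2.
  rewrite leNgt; apply/negP => pM; apply: (@ray_not_enclosed p (0, - 1)) Ep; first by right.
  by move=> t t0 [s _ [_ ys]]; have /andP[] := XMy s; rewrite ys /=; lra.
by rewrite !ler_norml H1 H2 H3 H4.
Qed.

(** * The curve is a measurable null set *)

Section Area.
Hypothesis yM_lt : forall s, - M < y s < M.
Notation mu := (@lebesgue_measure R).
Notation T := (measurableTypeR R).

(** Sup-norm balls around sample points, with the sampling step as radius; they cover the curve
    because it is 1-Lipschitz. The index [k = n + 1] is included for the endpoint [s = L]. *)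
Let square (n k : nat) : set (T * T) :=
  `[x (k%:R * (L / n.+1%:R)) - L / n.+1%:R, x (k%:R * (L / n.+1%:R)) + L / n.+1%:R] `*`
  `[y (k%:R * (L / n.+1%:R)) - L / n.+1%:R, y (k%:R * (L / n.+1%:R)) + L / n.+1%:R].

Let cover n := \big[setU/set0]_(k < n.+2) square n k.

Let e_gt0 n : 0 < L / n.+1%:R :> R. Proof. by rewrite divr_gt0. Qed.

Let curve_cover n : C `<=` cover n.
Proof.
move=> _ [s + <-]; rewrite /= in_itv /= => /andP[s0 sL].
set e := L / n.+1%:R; have e0 : 0 < e := e_gt0 n.
have se0 : 0 <= s / e by rewrite divr_ge0 // ltW.
have /andP[k1 k2] := truncn_itv se0; set k := Num.truncn _ in k1 k2.
have kn : (k < n.+2)%N.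
  rewrite ltnS -(ler_nat R); apply: le_trans k1 _.
  by rewrite ler_pdivrMr // /e mulrC mulfVK // pnatr_eq0.
rewrite /cover -bigcup_mkord; exists k => //=.
have ks : `|s - k%:R * e| <= e.
  move: k1 k2; rewrite ler_pdivlMr // ltr_pdivrMr // -natr1 mulrDl mul1r => ? ?.
  by rewrite ler_norml; lra.
have := le_trans (lipschitz1 dx speed_x s (k%:R * e)) ks.
have := le_trans (lipschitz1 dy speed_y s (k%:R * e)) ks.
rewrite /square /= !in_itv /= -/e !ler_norml => /andP[? ?] /andP[? ?].
by split; apply/andP; split; lra.
Qed.

Let measurable_square n k : measurable (square n k).
Proof. by apply: measurableX; exact: measurable_itv. Qed.

Let measurable_cover n : measurable (cover n).
Proof. by apply: bigsetU_measurable => k _; exact: measurable_square. Qed.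

(** A countable intersection of finite unions of rectangles, which yields measurability in the
    product sigma-algebra directly. *)
Let curve_bigcap : C = \bigcap_n cover n.
Proof.
apply/seteqP; split => [p Cp n _|p Hp]; first exact: curve_cover.
apply: contrapT => Cp; have [d d0 Dd] := curve_dist Cp.
pose e := Num.min 1 (d / 4).
have e0 : 0 < e by rewrite lt_min ltr01 divr_gt0.
have e1 : e <= 1 by rewrite ge_min lexx.
have ed : e <= d / 4 by rewrite ge_min lexx orbT.
clearbody e; pose n := Num.truncn (L / e).
have Le0 : 0 <= L / e by rewrite divr_ge0 // ltW.
have /andP[_] := truncn_itv Le0; rewrite -/n ltr_pdivrMr // => nL.
have ne : L / n.+1%:R <= e by rewrite ler_pdivrMr // mulrC ltW.
have := Hp n I; rewrite /cover -bigcup_mkord => -[k _].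
rewrite /square /= !in_itv /=; set t := _ * _ => -[/andP[? ?] /andP[? ?]].
have sq r : `|r| <= e -> r ^+ 2 <= e.
  move=> re; rewrite -(real_normK (num_real r)) expr2 -[leRHS]mulr1.
  by apply: ler_pM => //; lra.
have /sq ? : `|x t - p.1| <= e.
  by rewrite distrC; apply: le_trans ne; rewrite ler_distl; apply/andP.
have /sq ? : `|y t - p.2| <= e.
  by rewrite distrC; apply: le_trans ne; rewrite ler_distl; apply/andP.
by have := Dd t; rewrite /sqnorm; lra.
Qed.

Lemma measurable_curve : measurable (C : set (T * T)).
Proof. by rewrite curve_bigcap; apply: bigcapT_measurable. Qed.

Let square_area n k : lebesgue2 (square n k) = (4 * (L / n.+1%:R) ^+ 2)%:E.
Proof.
have itvE c (e : R) : 0 < e -> mu (`[c - e, c + e]%classic : set T) = (2 * e)%:E.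
  move=> e0; rewrite lebesgue_measure_itv /= lte_fin ifT; last by lra.
  by rewrite -EFinB; congr (_%:E); ring.
rewrite [LHS]product_measure1E; try exact: measurable_itv.
apply: (etrans (congr2 _ (itvE _ _ (e_gt0 n)) (itvE _ _ (e_gt0 n)))).
by rewrite -EFinM; congr (_%:E); ring.
Qed.

Lemma curve_null : lebesgue2 C = 0%E.
Proof.
apply/eqP; rewrite eq_le measure_ge0 andbT; apply/lee_addgt0Pr => e e0.
(* The cover has area at most [4 L^2 (n + 2) / (n + 1)^2 <= 8 L^2 / (n + 1)], which is below [e] for
   this [n]. *)
rewrite add0e; pose n := Num.truncn (8 * L ^+ 2 / e).
have Le0 : 0 <= 8 * L ^+ 2 / e by rewrite divr_ge0 ?mulr_ge0 ?sqr_ge0 // ltW.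
have /andP[_] := truncn_itv Le0; rewrite -/n ltr_pdivrMr // => nL.
apply: (@le_trans _ _ (lebesgue2 (cover n))).
  by apply: le_measure; rewrite ?inE; [exact: measurable_curve|exact: measurable_cover|exact: curve_cover].
apply: (@le_trans _ _ (\sum_(k < n.+2) lebesgue2 (square n k))%E).
  by rewrite /cover; apply: Boole_inequality => k _; exact: measurable_square.
rewrite (eq_bigr (fun=> (4 * (L / n.+1%:R) ^+ 2)%:E)) => [|k _]; last exact: square_area.
rewrite sumEFin sumr_const card_ord lee_fin -[X in X <= _]mulr_natr.
have n0 : 0 < n.+1%:R :> R by [].
have -> : 4 * (L / n.+1%:R) ^+ 2 * n.+2%:R = 4 * L ^+ 2 * n.+2%:R / n.+1%:R / n.+1%:R.
  by field; rewrite nat1r.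
rewrite !ler_pdivrMr //.
apply: (@le_trans _ _ (8 * L ^+ 2 * n.+1%:R)).
  have -> : 8 * L ^+ 2 * n.+1%:R = 4 * L ^+ 2 * (2 * n.+1%:R) by ring.
  have n2 : n.+2%:R = n.+1%:R + 1 :> R by rewrite -natr1.
  have n1 : 1 <= n.+1%:R :> R by rewrite ler1n.
  by apply: ler_wpM2l; [rewrite mulr_ge0 ?sqr_ge0|rewrite n2; lra].
by rewrite ler_pM2r // [e * _]mulrC ltW.
Qed.

(** * Fubini for the winding kernel on a long box *)

Section Box.
Variable U : R.
Hypothesis MU : 2 * M <= U.

Let I : set T := `[- U, U]%classic.
Let J : set T := `[- M, M]%classic.
Let S : set T := `[0, L]%classic.

(** [F1] is controlled by integrating over the height first, [F2] over the horizontal variable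
    first; in the other order a logarithm appears and the bound is not uniform. The indicators let
    every integral run over the whole space. *)
Let F1 (z : T * T * T) : R := \1_I z.1.1 * \1_J z.1.2 * \1_S z.2 *
  ((x z.2 - z.1.1) * derive1 y z.2 / sqnorm (x z.2 - z.1.1) (y z.2 - z.1.2)).
Let F2 (z : T * T * T) : R := \1_I z.1.1 * \1_J z.1.2 * \1_S z.2 *
  ((y z.2 - z.1.2) * derive1 x z.2 / sqnorm (x z.2 - z.1.1) (y z.2 - z.1.2)).
Let F z := F1 z - F2 z.

Let FE p s : F (p, s) = \1_I p.1 * \1_J p.2 * (\1_S s * wkernel p s).
Proof. by rewrite /F /F1 /F2 /wkernel /=; ring. Qed.

Let mI : measurable I. Proof. exact: measurable_itv. Qed.
Let mJ : measurable J. Proof. exact: measurable_itv. Qed.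
Let mS : measurable S. Proof. exact: measurable_itv. Qed.

Let box_finite a b : (mu (`[a, b]%classic : set T) < +oo)%E.
Proof. by rewrite lebesgue_measure_itv /=; case: ifP => _; rewrite ?ltry // -EFinB ltry. Qed.

Let m11 : measurable_fun setT (fun z : T * T * T => z.1.1).
Proof. exact: measurableT_comp measurable_fst measurable_fst. Qed.
Let m12 : measurable_fun setT (fun z : T * T * T => z.1.2).
Proof. exact: measurableT_comp measurable_snd measurable_fst. Qed.
Let m2 : measurable_fun setT (fun z : T * T * T => z.2).
Proof. exact: measurable_snd. Qed.

Let mcomp (f : R -> R) : continuous f ->
  measurable_fun setT (fun z : T * T * T => f z.2).
Proof. by move=> cf; apply: measurableT_comp m2; exact: continuous_measurable_fun. Qed.

Let mden : measurable_fun setT (fun z : T * T * T =>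
  (sqnorm (x z.2 - z.1.1) (y z.2 - z.1.2))^-1).
Proof.
(* Inversion is discontinuous at 0, a value taken on the curve. The power with exponent -1 is
   measurable everywhere and agrees with it on nonnegative numbers, 0 included. *)
have -> : (fun z : T * T * T => (sqnorm (x z.2 - z.1.1) (y z.2 - z.1.2))^-1) =
    (fun z => powR (sqnorm (x z.2 - z.1.1) (y z.2 - z.1.2)) (- 1)).
  by apply/funext => z; rewrite powR_inv1 // addr_ge0 ?sqr_ge0.
apply: (measurableT_comp (measurable_powR (- 1))).
by apply: measurable_funD; apply: measurable_funX; apply: measurable_funB => //; exact: mcomp.
Qed.

Let mind : measurable_fun setT (fun z : T * T * T => \1_I z.1.1 * \1_J z.1.2 * \1_S z.2 : R).
Proof.
apply: measurable_funM; first apply: measurable_funM.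
- by apply: (measurableT_comp _ m11); exact: measurable_indic.
- by apply: (measurableT_comp _ m12); exact: measurable_indic.
- by apply: (measurableT_comp _ m2); exact: measurable_indic.
Qed.

Let mF1 : measurable_fun setT F1.
Proof.
apply: measurable_funM => //; apply: measurable_funM => //.
apply: measurable_funM; last exact: mcomp.
by apply: measurable_funB => //; exact: mcomp.
Qed.

Let mF2 : measurable_fun setT F2.
Proof.
apply: measurable_funM => //; apply: measurable_funM => //.
apply: measurable_funM; last exact: mcomp.
by apply: measurable_funB => //; exact: mcomp.
Qed.

Let indic01 (A : set T) t : 0 <= (\1_A t : R) <= 1.
Proof. by rewrite indicE; case: (t \in A); rewrite /= ?lexx ler01. Qed.

Let poisson_bound (A B : set T) (lo hi c a a1 : R) (G : T -> R) t t' :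
  lo <= hi -> `|a1| <= 1 ->
  (forall v, G v = \1_A t * \1_B t' * \1_`[lo, hi] v * (a * a1 / (a ^+ 2 + (c - v) ^+ 2))) ->
  (\int[mu]_v `|(G v)%:E| <= (pi * \1_A t * \1_B t')%:E)%E.
Proof.
move=> lohi a1le GE; have /andP[A0 A1] := indic01 A t.
have /andP[B0 B1] := indic01 B t'.
pose g v := `|a| / (a ^+ 2 + (c - v) ^+ 2).
have g0 v : 0 <= g v by rewrite divr_ge0 // addr_ge0 ?sqr_ge0.
have mg : measurable_fun setT (fun v : T => \1_`[lo, hi] v * g v).
  apply: measurable_funM; first exact: measurable_indic.
  rewrite /g (_ : (fun v => _) = (fun v => `|a| * powR (a ^+ 2 + (c - v) ^+ 2) (- 1))).
    apply: measurable_funM => //; apply: (measurableT_comp (measurable_powR (- 1))).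
    by apply: continuous_measurable_fun; cont.
  by apply/funext => v; rewrite powR_inv1 // addr_ge0 ?sqr_ge0.
have ig0 v : 0 <= \1_`[lo, hi] v * g v.
  by rewrite mulr_ge0 //; have /andP[] := indic01 `[lo, hi]%classic v.
apply: (@le_trans _ _ (\int[mu]_v ((\1_A t * \1_B t')%:E * (\1_`[lo, hi] v * g v)%:E))%E).
  apply: ge0_le_integral => //.
  (* The factor [a] is split into sign and modulus, which reduces measurability to that of [g]. *)
  - rewrite (_ : (fun v => _) = (fun v => `|(\1_A t * \1_B t' * (\1_`[lo, hi] v * g v) * (Num.sg a * a1))%:E|%E)).
      apply: measurableT_comp => //; apply/measurable_EFinP.
      by apply: measurable_funM => //; apply: measurable_funM.
    apply/funext => v; rewrite GE /g; congr (`| _%:E |)%E.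
    by rewrite {1}(numEsg a) -!mulrA; congr (_ * (_ * (_ * _))); ring.
  - by apply/measurable_EFinP; apply: measurable_funM.
  - move=> v _; rewrite -EFinM abse_EFin lee_fin GE !normrM.
    rewrite !(ger0_norm A0, ger0_norm B0) -!mulrA.
    apply: ler_wpM2l => //; apply: ler_wpM2l => //.
    have /andP[J0 _] := indic01 `[lo, hi]%classic v.
    rewrite (ger0_norm J0); apply: ler_wpM2l => //; rewrite /g; apply: ler_wpM2l => //.
    have inv0 : 0 <= (a ^+ 2 + (c - v) ^+ 2)^-1 by rewrite invr_ge0 addr_ge0 ?sqr_ge0.
    by rewrite (ger0_norm inv0); apply: ler_piMl.
rewrite ge0_integralZl_EFin;
  do ?[exact: measurableT | exact/measurable_EFinP | by rewrite mulr_ge0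
    | by move=> v _; rewrite lee_fin].
have -> : pi * \1_A t * \1_B t' = (\1_A t * \1_B t') * pi :> R by ring.
rewrite [X in (_ <= X)%E]EFinM.
apply: lee_pmul; rewrite ?lee_fin ?mulr_ge0 //; last exact: poisson_le.
by apply: integral_ge0 => v _; rewrite lee_fin.
Qed.

Let MM : - M <= M. Proof. by have := M0; lra. Qed.
Let UU : - U <= U. Proof. by have := M0; have := MU; lra. Qed.

Let F1_bound u s : (\int[mu]_v `|(F1 (u, v, s))%:E| <= (pi * \1_I u * \1_S s)%:E)%E.
Proof.
apply: (@poisson_bound I S _ _ (y s) (x s - u) (derive1 y s) _ _ _ MM (speed_y s)) => v.
by rewrite /F1 /sqnorm /=; ring.
Qed.

Let F2_bound v s : (\int[mu]_u `|(F2 (u, v, s))%:E| <= (pi * \1_J v * \1_S s)%:E)%E.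
Proof.
apply: (@poisson_bound J S _ _ (x s) (y s - v) (derive1 x s) _ _ _ UU (speed_x s)) => u.
by rewrite /F2 /sqnorm /= [_ + (y s - v) ^+ 2]addrC; ring.
Qed.

Let pi0 : 0 <= (pi : R). Proof. exact: pi_ge0. Qed.

Let F_integrable : ((@lebesgue2 R \x mu).-integrable setT (EFin \o F))%E.
Proof.
have i1 := @space_integrable1 _ F1 pi S mF1 pi0 mS (box_finite _ _) I mI (box_finite _ _) F1_bound.
have i2 := @space_integrable2 _ F2 pi S mF2 pi0 mS (box_finite _ _) J mJ (box_finite _ _) F2_bound.
have -> : EFin \o F = (fun z => (EFin \o F1) z - (EFin \o F2) z)%E by [].
exact: integrableB.
Qed.

(** Fubini on the triple product gives this for almost every [s] only; the uniform bounds give it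
    for every [s], and with it the finiteness of all the slice integrals. *)
Let slice_integrable s : ((mu \x mu).-integrable setT (fun p : T * T => (F (p, s))%:E))%E.
Proof.
have c0 : 0 <= pi * \1_S s :> R by rewrite mulr_ge0.
have i1 : ((mu \x mu).-integrable setT (EFin \o (fun p : T * T => F1 (p, s))))%E.
  apply: (@prod_integrable1 _ _ _ _ _ mu mu _ _ (measurable_slice mF1 s) c0 I mI (box_finite _ _)) => u.
  by rewrite mulrAC; exact: F1_bound.
have i2 : ((mu \x mu).-integrable setT (EFin \o (fun p : T * T => F2 (p, s))))%E.
  apply: (@prod_integrable2 _ _ _ _ _ mu mu _ _ (measurable_slice mF2 s) c0 J mJ (box_finite _ _)) => u.
  by rewrite mulrAC; exact: F2_bound.
have -> : (fun p : T * T => (F (p, s))%:E) =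
  (fun p => (EFin \o (fun p : T * T => F1 (p, s))) p - (EFin \o (fun p : T * T => F2 (p, s))) p)%E by [].
exact: integrableB.
Qed.

Let e := 16 * M / U.

Let fiber s v : T -> R := fun u => F (u, v, s).

Let fiber_int s v := (\int[mu]_u (fiber s v u)%:E)%E.

Let fiber_out s v : v \notin J -> fiber_int s v = 0%E.
Proof.
move=> vJ; rewrite /fiber_int integral0_eq // => u _.
by rewrite /fiber FE /= [\1_J v]indicE (negPf vJ) mulr0 mul0r.
Qed.

Let fiber_in s v : s \in S -> v \in J -> y s != v -> fiber_int s v =
  (itg (- U) U (fun u => ((x s - u) * derive1 y s - (y s - v) * derive1 x s) /
     ((x s - u) ^+ 2 + (y s - v) ^+ 2)))%:E.
Proof.
move=> sS vJ yv; rewrite -itg_EFin; last first.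
  apply: contM; first by cont.
  apply: contV => [u|]; last by cont.
  by rewrite lt0r_neq0 // ltr_wpDl ?sqr_ge0 // exprn_even_gt0 //= subr_eq0.
rewrite -(integral_indicM _ mI); apply: eq_integral => u _; congr (_%:E).
have vJ' : \1_J v = 1 :> R by rewrite indicE vJ.
have sS' : \1_S s = 1 :> R by rewrite indicE sS.
by rewrite /fiber FE /= vJ' sS' /wkernel /sqnorm /=; ring.
Qed.

(** A real-valued version of the line integral. The height [v = y s] is exceptional: there the
    integrand is [y' / (x - u)], in general not integrable, but a single height is negligible. *)
Let q s v := fine (fiber_int s v).

Let fiber_fine s v : s \in S -> y s != v -> fiber_int s v = (q s v)%:E.
Proof.
move=> sS yv; rewrite /q; have [vJ|vJ] := boolP (v \in J).
  by rewrite fiber_in.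
by rewrite fiber_out.
Qed.

(** The heights below the curve point weigh [- pi x' (y + M)], those above weigh [pi x' (M - y)];
    [M] cancels and [- 2 pi x' y] remains. The error [e] accumulates over a total height [2 M]. *)
Let slice_bound s : s \in S ->
  `|fine (\int[mu \x mu]_p (F (p, s))%:E)%E + 2 * pi * (derive1 x s * y s)| <= e * (2 * M).
Proof.
move=> sS; have iF := slice_integrable s.
have iG : mu.-integrable setT (fiber_int s) := integrable_fubini_G iF.
have mG : measurable_fun setT (fiber_int s) := measurable_int _ iG.
have mq : measurable_fun setT (q s).
  by apply: measurableT_comp mG; exact: fine_measurable.
have ae : ae_eq mu setT (fiber_int s) (EFin \o q s).
  exists [set y s]; split => //; first exact: lebesgue_measure_set1.
  move=> v /= H; apply: contrapT => vy; apply: H => _.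
  by apply: fiber_fine => //; apply/eqP => yE; apply: vy.
have mqe : measurable_fun setT (EFin \o q s) by exact/measurable_EFinP.
have iq : mu.-integrable setT (EFin \o q s).
  apply/integrableP; split => //.
  rewrite (@ae_eq_integral _ _ _ _ setT (abse \o fiber_int s)) //.
  - by have /integrableP[] := iG.
  - exact: measurableT_comp.
  - exact: measurableT_comp.
  - by apply: filterS ae => v H _; have := H Logic.I; rewrite /comp => ->.
have -> : (\int[mu \x mu]_p (F (p, s))%:E)%E = (\int[mu]_v (q s v)%:E)%E.
  by rewrite -(integral21_prod_meas1 iF); exact: ae_eq_integral.
have -> : fine (\int[mu]_v (q s v)%:E)%E = Rintegral mu J (q s).
  rewrite /Rintegral [in RHS]integral_mkcond; congr (fine _); apply: eq_integral => v _.
  by rewrite patchE; case: ifPn => // vJ; rewrite /q fiber_out.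
have iqJ (A : set T) : measurable A -> mu.-integrable A (EFin \o q s).
  by move=> mA; apply: integrableS iq.
(* Strictness makes both pieces of [[-M, M]], below and above [y s], nondegenerate. *)
have /andP[y1 y2] := yM_lt s.
have [xM yM] := XM s.
have E : Rintegral mu J (q s) =
    Rintegral mu `[- M, y s[ (q s) + Rintegral mu `]y s, M] (q s).
  rewrite Rintegral_itv_bndo_bndc; last by apply: iqJ; exact: measurable_itv.
  rewrite -(@Rintegral_itvB _ _ (BLeft (- M)) (BRight M) (y s)).
  - by rewrite addrC subrK.
  - by apply: iqJ; exact: measurable_itv.
  - by rewrite bnd_simp ltW.
  - by rewrite bnd_simp ltW.
have muE (a b : R) b1 b2 : a < b ->
    mu ([set` Interval (BSide b1 a) (BSide b2 b)] : set T) = (b - a)%:E.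
  by move=> ab; rewrite lebesgue_measure_itv /= lte_fin ab -EFinB.
have cstE (c a b : R) b1 b2 : a < b ->
    Rintegral mu [set` Interval (BSide b1 a) (BSide b2 b)] (fun=> c) = c * (b - a).
  move=> ab; rewrite Rintegral_cst; last exact: measurable_itv.
  by congr (_ * _); rewrite -[RHS]/(fine (b - a)%:E); congr fine; exact: muE.
have icst (c a b : R) b1 b2 : a < b ->
    mu.-integrable [set` Interval (BSide b1 a) (BSide b2 b)] (EFin \o (fun=> c)).
  move=> ab; apply/integrableP; split; first exact/measurable_EFinP.
  rewrite /= integral_cst; last exact: measurable_itv.
  rewrite lte_mul_pinfty //; apply: (@le_lt_trans _ _ (b - a)%:E); last exact: ltry.
  by rewrite le_eqVlt; apply/orP; left; apply/eqP; exact: muE.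
have low v : v \in (`[- M, y s[%classic : set T) ->
    - derive1 x s * pi - e <= q s v <= - derive1 x s * pi + e.
  rewrite inE /= in_itv /= => /andP[v1 v2].
  have vJ : v \in J by rewrite inE /J /= in_itv /= v1 /=; lra.
  have vM : `|v| <= M by rewrite ler_norml v1; lra.
  rewrite /q fiber_in ?gt_eqF //.
  exact: (kernel_itg_below M0 MU xM yM vM (speed_y s) (speed_x s) v2).
have high v : v \in (`]y s, M]%classic : set T) ->
    derive1 x s * pi - e <= q s v <= derive1 x s * pi + e.
  rewrite inE /= in_itv /= => /andP[v1 v2].
  have vJ : v \in J by rewrite inE /J /= in_itv /= v2 andbT; lra.
  have vM : `|v| <= M by rewrite ler_norml v2 andbT; lra.
  rewrite /q fiber_in ?lt_eqF //.
  exact: (kernel_itg_above M0 MU xM yM vM (speed_y s) (speed_x s) v1).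
have l1 : (- derive1 x s * pi - e) * (y s - - M) <= Rintegral mu `[- M, y s[ (q s).
  rewrite -(cstE _ _ _ true true y1); apply: le_Rintegral => [|||v vA]; first exact: measurable_itv.
  - exact: icst.
  - by apply: iqJ; exact: measurable_itv.
  - by have /andP[] := low v (mem_set vA).
have l2 : Rintegral mu `[- M, y s[ (q s) <= (- derive1 x s * pi + e) * (y s - - M).
  rewrite -(cstE _ _ _ true true y1); apply: le_Rintegral => [|||v vA]; first exact: measurable_itv.
  - by apply: iqJ; exact: measurable_itv.
  - exact: icst.
  - by have /andP[] := low v (mem_set vA).
have h1 : (derive1 x s * pi - e) * (M - y s) <= Rintegral mu `]y s, M] (q s).
  rewrite -(cstE _ _ _ false false y2); apply: le_Rintegral => [|||v vA]; first exact: measurable_itv.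
  - exact: icst.
  - by apply: iqJ; exact: measurable_itv.
  - by have /andP[] := high v (mem_set vA).
have h2 : Rintegral mu `]y s, M] (q s) <= (derive1 x s * pi + e) * (M - y s).
  rewrite -(cstE _ _ _ false false y2); apply: le_Rintegral => [|||v vA]; first exact: measurable_itv.
  - by apply: iqJ; exact: measurable_itv.
  - exact: icst.
  - by have /andP[] := high v (mem_set vA).
rewrite E ler_norml; move: l1 l2 h1 h2.
set R1 := Rintegral _ _ _; set R2 := Rintegral _ _ _.
set P := (pi : R); move: e => e'; move: (derive1 x s) (y s) => a b.
have -> : (- a * P - e') * (b - - M) = - (a * P * b) - a * P * M - e' * b - e' * M by ring.
have -> : (- a * P + e') * (b - - M) = - (a * P * b) - a * P * M + e' * b + e' * M by ring.
have -> : (a * P - e') * (M - b) = - (a * P * b) + a * P * M + e' * b - e' * M by ring.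
have -> : (a * P + e') * (M - b) = - (a * P * b) + a * P * M - e' * b + e' * M by ring.
have -> : 2 * P * (a * b) = 2 * (a * P * b) by ring.
have -> : e' * (2 * M) = 2 * (e' * M) by ring.
lra.
Qed.

Let total s : \bar R := (\int[mu \x mu]_p (F (p, s))%:E)%E.

Let total_fin s : total s \is a fin_num.
Proof. exact: (integrable_fin_num _ (slice_integrable s)). Qed.

Let total_integral : integrable mu setT total /\
  (\int[@lebesgue2 R]_p \int[mu]_s (F (p, s))%:E = \int[mu]_s total s)%E.
Proof.
split; first exact: (@integrable_fubini_G _ _ _ _ _ (@lebesgue2 R) mu _ F_integrable).
exact: (@Fubini _ _ _ _ _ (@lebesgue2 R) mu _ F_integrable).
Qed.

Let total_out s : s \notin S -> total s = 0%E.
Proof.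
move=> sS; rewrite /total integral0_eq // => p _.
by rewrite FE [\1_S s]indicE (negPf sS) mul0r mulr0.
Qed.

Let total_bound : `|fine (\int[mu]_s total s)%E + 2 * pi * itg 0 L (fun s => derive1 x s * y s)|
  <= e * (2 * M) * L.
Proof.
have [it _] := total_integral.
have itq : mu.-integrable setT (EFin \o (fine \o total)).
  by apply: eq_integrable it => // s _; rewrite /= fineK.
have -> : fine (\int[mu]_s total s)%E = Rintegral mu S (fine \o total).
  rewrite /Rintegral [in RHS]integral_mkcond; congr fine; apply: eq_integral => s _.
  by rewrite patchE /= fineK //; case: ifPn => // /total_out ->.
have iS : mu.-integrable S (EFin \o (fine \o total)) by exact: integrableS itq.
pose g s := - (2 * pi) * (derive1 x s * y s).
have cg : continuous g by rewrite /g; cont.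
set c := e * (2 * M).
have Bs s : S s -> g s - c <= (fine \o total) s <= g s + c.
  move=> /mem_set/slice_bound; rewrite ler_norml -/(total s) -/c /g /=.
  by move=> /andP[? ?]; apply/andP; split; lra.
have E k : itg 0 L (fun s => g s + k) =
    - (2 * pi) * itg 0 L (fun s => derive1 x s * y s) + k * L.
  rewrite itgD //; last exact: cont_cst.
  by rewrite itg_cst ?(ltW L0) // subr0 /g itgZ //; cont.
have l1 : itg 0 L (fun s => g s + - c) <= Rintegral mu S (fine \o total).
  apply: le_Rintegral => //; first by apply: cont_itg_integrable; cont.
  by move=> s /Bs /andP[].
have l2 : Rintegral mu S (fine \o total) <= itg 0 L (fun s => g s + c).
  apply: le_Rintegral => //; first by apply: cont_itg_integrable; cont.
  by move=> s /Bs /andP[].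
move: l1 l2; rewrite !E ler_norml; move: (itg _ _ _) (Rintegral _ _ _) (2 * pi) => a b d.
by rewrite !mulNr => ? ?; apply/andP; split; lra.
Qed.

Hypothesis wind1 : ccw x y L.

Let E := enclosed x y L.

(** The box indicators disappear: enclosed points lie in the box, and at all other points off the
    curve the winding number is zero. *)
Let inner_value p : ~ C p ->
  (\int[mu]_s (F (p, s))%:E = (2 * pi * \1_E p)%:E)%E.
Proof.
move=> Cp; have pi0' : pi != 0 :> R by rewrite lt0r_neq0 // pi_gt0.
have -> : (\int[mu]_s (F (p, s))%:E = (\1_I p.1 * \1_J p.2)%:E * (2 * pi * winding x y L p)%:E)%E.
  have -> : 2 * pi * winding x y L p = itg 0 L (wkernel p).
    by rewrite windingE mulrA mulfV ?mul1r // mulf_neq0.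
  rewrite -itg_EFin; last exact: wkernel_cont.
  rewrite -integralZl //; last exact: cont_itg_integrable (wkernel_cont Cp).
  rewrite [RHS]integral_mkcond; apply: eq_integral => s _; rewrite patchE FE.
  by case: ifPn => sS; rewrite [\1_S s]indicE ?sS ?(negPf sS) ?mul1r ?mul0r ?mulr0 // EFinM.
rewrite -EFinM; congr (_%:E); have [pE|pE] := pselect (E p).
  have [p1 p2] := enclosed_bounded pE.
  rewrite [\1_E p]indicE (mem_set pE) wind1 //.
  have -> : \1_I p.1 = 1 :> R.
    rewrite indicE mem_set // /I /= in_itv /=; move: p1; rewrite ler_norml.
    by have := M0; have := MU; lra.
  have -> : \1_J p.2 = 1 :> R.
    by rewrite indicE mem_set // /J /= in_itv /=; move: p2; rewrite ler_norml.
  by rewrite !mul1r.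
rewrite (winding_not_enclosed Cp pE) [\1_E p]indicE memNset //.
by rewrite !mulr0.
Qed.

Let inner_measurable : measurable_fun setT (fun p : T * T => \int[mu]_s (F (p, s))%:E)%E.
Proof. exact: (@measurable_fubini_F _ _ _ _ _ (@lebesgue2 R) mu _ F_integrable). Qed.

(** Off the curve, [E] is the level set [2 pi] of a measurable function; on the curve [inner_value]
    says nothing, so [C] is removed. *)
Let measurable_enclosed : measurable (E : set (T * T)).
Proof.
have -> : (E : set (T * T)) = (setT `&` (fun p : T * T => \int[mu]_s (F (p, s))%:E)%E @^-1` [set (2 * pi)%:E]) `\` C.
  have pi0' : 2 * pi != 0 :> R by rewrite mulf_neq0 // lt0r_neq0 // pi_gt0.
  apply/seteqP; split => [p pE|p [[_ /= pi2] Cp]].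
    have Cp : ~ C p by case: pE.
    by split => //; split => //=; rewrite inner_value // indicE mem_set // mulr1.
  apply: contrapT => pE; move: pi2; rewrite inner_value // indicE memNset // mulr0.
  by move=> [/esym/eqP]; rewrite (negPf pi0').
apply: measurableD; last exact: measurable_curve.
by apply: inner_measurable => //; exact: emeasurable_set1.
Qed.

Lemma area_winding_bound (A : R) : area2 E = A%:E ->
  `|2 * pi * A + 2 * pi * itg 0 L (fun s => derive1 x s * y s)| <= e * (2 * M) * L.
Proof.
move=> EA; have [_ FF] := total_integral.
have <- : fine (\int[mu]_s total s)%E = 2 * pi * A; last exact: total_bound.
rewrite -FF (@ae_eq_integral _ _ _ _ setT (fun p : T * T => (2 * pi * \1_(E : set (T * T)) p)%:E)) //.
- transitivity (fine ((2 * pi)%:E * A%:E)%E); last by rewrite -EFinM.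
  congr fine; rewrite integral_indic_cst ?mulr_ge0 ?pi_ge0 //.
  by congr (_ * _)%E; exact: EA.
- exact: measurable_cst_indic.
- exists C; split; [exact: measurable_curve|exact: curve_null|].
  move=> p /= H; apply: contrapT => Cp; apply: H => _; exact: inner_value.
Qed.

End Box.

Lemma area_formula (A : R) : ccw x y L -> area2 (enclosed x y L) = A%:E ->
  A = - itg 0 L (fun s => derive1 x s * y s).
Proof.
move=> wind1 EA; set B := itg _ _ _; apply/eqP; rewrite -addr_eq0 -normr_eq0.
rewrite eq_le normr_ge0 andbT leNgt; apply/negP => AB0.
have M0' := M0; have L0' := L0; have pi0 : 0 < pi :> R := pi_gt0 R.
(* The total error is [32 M^2 L / U], at most [W] for this [U], while the quantity it bounds is
   [2 pi W]. *)
pose W := `|A + B|; pose U := 2 * M + 32 * M ^+ 2 * L / W.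
have W0 : 0 < W by [].
have K0 : 0 < 32 * M ^+ 2 * L by rewrite !mulr_gt0 // exprn_gt0.
have MU : 2 * M <= U by rewrite /U lerDl divr_ge0 // ltW.
have U0 : 0 < U by apply: lt_le_trans MU; lra.
have := area_winding_bound MU wind1 EA.
rewrite -/B -mulrDr normrM -/W (gtr0_norm (_ : 0 < 2 * pi)) ?mulr_gt0 //.
have -> : 16 * M / U * (2 * M) * L = 32 * M ^+ 2 * L / U by field; rewrite lt0r_neq0.
rewrite ler_pdivlMr // leNgt => /negP; apply.
have UW : 32 * M ^+ 2 * L <= U * W.
  have -> : U * W = 2 * M * W + 32 * M ^+ 2 * L by rewrite /U; field; rewrite lt0r_neq0.
  by rewrite lerDr !mulr_ge0 // ltW.
apply: le_lt_trans UW _; rewrite [U * W]mulrC ltr_pM2r // ltr_pMl //.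
by have := pi_ge2 R; lra.
Qed.

End Area.

End Bounded.

End Winding.

(** * Curves with two Fourier modes *)

Section Circle.
Variable R : realType.
Implicit Types (a b c d p q r s t u v w : R).

Lemma angle_of_unit_vector p q : p ^+ 2 + q ^+ 2 = 1 ->
  exists t, [/\ 0 <= t, t < 2 * pi, cos t = p & sin t = q].
Proof.
move=> pq; have pi0 := pi_gt0 R.
have p1 : -1 <= p <= 1.
  by rewrite -ler_norml -(@expr_le1 _ 2) // real_normK ?num_real //; have := sqr_ge0 q; lra.
have sE : sin (acos p) = `|q|.
  by rewrite sin_acos // -sqrtr_sqr; congr Num.sqrt; lra.
have a0 := acos_ge0 p1; have ap := acos_lepi p1.
have [q0|q0] := leP 0 q.
  by exists (acos p); split; [|lra|exact: acosK|rewrite sE ger0_norm].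
have aN0 : acos p != 0.
  by apply/eqP => a00; move: sE; rewrite a00 sin0 => /esym/eqP; rewrite normr_eq0 => /eqP; lra.
exists (2 * pi - acos p); split.
- by lra.
- by have : 0 < acos p; [rewrite lt_def aN0|lra].
- by rewrite (_ : 2 * pi - acos p = - acos p + pi *+ 2); [rewrite cosD2pi cosN acosK|ring].
- rewrite (_ : 2 * pi - acos p = - acos p + pi *+ 2); last by ring.
  by rewrite sinD2pi sinN sE ltr0_norm // opprK.
Qed.

Lemma cos_lt1 t : 0 < t -> t < 2 * pi -> cos t != 1.
Proof.
move=> t0 t2; apply/eqP => ct; have := @sin_gt0_pi R (t / 2).
rewrite divr_gt0 //= ltr_pdivrMr // mulrC => /(_ t2) st.
move: ct; rewrite (_ : t = (t / 2) *+ 2); last by rewrite -mulr_natr mulfVK.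
rewrite cos_mulr2n => ct; have := cos2Dsin2 (t / 2).
by have := exprn_gt0 2 st; lra.
Qed.

(** Two nonzero orthogonal vectors span the plane; Lagrange's identity shows that their determinant
    [D] is nonzero, and Cramer's rule does the rest. *)
Lemma orthogonal_plane_eq0 u1 u2 v1 v2 w1 w2 : u1 * v1 + u2 * v2 = 0 ->
  u1 ^+ 2 + u2 ^+ 2 = v1 ^+ 2 + v2 ^+ 2 -> u1 ^+ 2 + u2 ^+ 2 != 0 ->
  u1 * w1 + u2 * w2 = 0 -> v1 * w1 + v2 * w2 = 0 -> w1 = 0 /\ w2 = 0.
Proof.
move=> uv nuv n0 uw vw; pose D := u1 * v2 - u2 * v1.
have D2 : D ^+ 2 = (u1 ^+ 2 + u2 ^+ 2) ^+ 2.
  transitivity ((u1 ^+ 2 + u2 ^+ 2) * (v1 ^+ 2 + v2 ^+ 2) - (u1 * v1 + u2 * v2) ^+ 2).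
    by rewrite /D; ring.
  by rewrite uv -nuv; ring.
have D0 : D != 0 by rewrite -sqrf_eq0 D2 sqrf_eq0.
split; apply/eqP; rewrite -(mulrI_eq0 _ (mulfI D0)); apply/eqP.
  transitivity (v2 * (u1 * w1 + u2 * w2) - u2 * (v1 * w1 + v2 * w2)).
    by rewrite /D; ring.
  by rewrite uw vw; ring.
transitivity (u1 * (v1 * w1 + v2 * w2) - v1 * (u1 * w1 + u2 * w2)).
  by rewrite /D; ring.
by rewrite uw vw; ring.
Qed.

(* The vectors U, V, W, Z are the Fourier coefficients of the unit tangent; the
   eight points (+-1, 0), (0, +-1), (+-r, +-r) determine all their inner products. *)
Lemma unit_tangent_modes u1 u2 v1 v2 w1 w2 z1 z2 :
  (forall p q, p ^+ 2 + q ^+ 2 = 1 ->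
    (u1 * p + v1 * q + (w1 * (2 * p ^+ 2 - 1) + z1 * (2 * p * q))) ^+ 2 +
    (u2 * p + v2 * q + (w2 * (2 * p ^+ 2 - 1) + z2 * (2 * p * q))) ^+ 2 = 1) ->
  [/\ u1 * v1 + u2 * v2 = 0, u1 ^+ 2 + u2 ^+ 2 = v1 ^+ 2 + v2 ^+ 2 &
    u1 ^+ 2 + u2 ^+ 2 != 0 -> [/\ u1 ^+ 2 + u2 ^+ 2 = 1, w1 = 0, w2 = 0, z1 = 0 & z2 = 0]].
Proof.
move=> H; pose r : R := Num.sqrt 2^-1.
have r2 : r ^+ 2 = 2^-1 by rewrite sqr_sqrtr.
have r0 : r != 0 by apply/eqP => r0; move: r2; rewrite r0 expr0n /=; lra.
have E1 := H 1 0 ltac:(by rewrite expr1n expr0n addr0).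
have E2 := H (- 1) 0 ltac:(by rewrite sqrrN expr1n expr0n addr0).
have E3 := H 0 1 ltac:(by rewrite expr1n expr0n add0r).
have E4 := H 0 (- 1) ltac:(by rewrite sqrrN expr1n expr0n add0r).
have rr : r ^+ 2 + r ^+ 2 = 1 by rewrite r2; field.
have E5 := H r r rr.
have E6 := H (- r) (- r) ltac:(by rewrite sqrrN).
have E7 := H (- r) r ltac:(by rewrite sqrrN).
have E8 := H r (- r) ltac:(by rewrite sqrrN).
have h1 : 2 * r ^+ 2 - 1 = 0 by rewrite r2; field.
have h2 : 2 * r * r = 1 by rewrite -mulrA -expr2 r2; field.
have h3 : 2 * r * - r = - 1 by rewrite mulrN h2.
have h4 : 2 * - r * r = - 1 by rewrite mulrN mulNr h2.
have h5 : 2 * - r * - r = 1 by rewrite mulrN h4 opprK.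
move: E5 E6 E7 E8; rewrite !sqrrN h1 h2 h3 h4 h5 => E5 E6 E7 E8.
(* At antipodal points the first mode changes sign and the second does not: differences isolate the
   inner products between the modes, sums isolate the squared norms. *)
have diff (A B X : R) : A = 1 -> B = 1 -> A - B = 4 * X -> X = 0.
  by move=> -> ->; rewrite subrr => /esym/eqP; rewrite mulf_eq0 pnatr_eq0 /= => /eqP.
have sum (A B X : R) : A = 1 -> B = 1 -> A + B = 2 * X -> X = 1.
  by move=> -> -> AB; lra.
have UW : u1 * w1 + u2 * w2 = 0 by apply: (diff _ _ _ E1 E2); ring.
have VW : v1 * w1 + v2 * w2 = 0.
  by apply: oppr_inj; rewrite oppr0; apply: (diff _ _ _ E3 E4); ring.
have nU : u1 ^+ 2 + u2 ^+ 2 + (w1 ^+ 2 + w2 ^+ 2) = 1.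
  by apply: (sum _ _ _ E1 E2); ring.
have nV : v1 ^+ 2 + v2 ^+ 2 + (w1 ^+ 2 + w2 ^+ 2) = 1.
  by apply: (sum _ _ _ E3 E4); ring.
have rI (X : R) : r * X = 0 -> X = 0.
  by move/eqP; rewrite mulf_eq0 (negPf r0) => /eqP.
have m1 : (u1 + v1) * z1 + (u2 + v2) * z2 = 0.
  by apply: (rI); apply: (diff _ _ _ E5 E6); ring.
have m2 : (u1 - v1) * z1 + (u2 - v2) * z2 = 0.
  by apply: (rI); apply: (diff _ _ _ E7 E8); ring.
have half (A B X : R) : A = 0 -> B = 0 -> A + B = 2 * X -> X = 0.
  by move=> -> -> AB; lra.
have m1' : - ((u1 + v1) * z1 + (u2 + v2) * z2) = 0 by rewrite m1 oppr0.
have UZ : u1 * z1 + u2 * z2 = 0 by apply: (half _ _ _ m1 m2); ring.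
have VZ : v1 * z1 + v2 * z2 = 0.
  by apply: oppr_inj; rewrite oppr0; apply: (half _ _ _ m2 m1'); ring.
have nUV : r ^+ 2 * ((u1 + v1) ^+ 2 + (u2 + v2) ^+ 2) + (z1 ^+ 2 + z2 ^+ 2) = 1.
  by apply: (sum _ _ _ E5 E6); ring.
have nUV' : r ^+ 2 * ((u1 - v1) ^+ 2 + (u2 - v2) ^+ 2) + (z1 ^+ 2 + z2 ^+ 2) = 1.
  by apply: (sum _ _ _ E7 E8); ring.
have UV : u1 * v1 + u2 * v2 = 0.
  by apply: (rI); apply: (rI); apply: (diff _ _ _ nUV nUV'); ring.
have UVn : u1 ^+ 2 + u2 ^+ 2 = v1 ^+ 2 + v2 ^+ 2.
  by apply: (addIr (w1 ^+ 2 + w2 ^+ 2)); rewrite nU nV.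
split => // n0.
have [w10 w20] := orthogonal_plane_eq0 UV UVn n0 UW VW.
have [z10 z20] := orthogonal_plane_eq0 UV UVn n0 UZ VZ.
by split => //; move: nU; rewrite w10 w20 expr0n /=; lra.
Qed.

End Circle.

(** * The isoperimetric inequalities *)

Lemma quartic_form_split (R : realType) (w L f0 f1 f2 g0 g1 g2 : R) : f1 + g1 = L ->
  f2 + g2 - 5 * w ^+ 2 * L + 4 * w ^+ 4 * (f0 + g0) =
  (f2 - 5 * w ^+ 2 * f1 + 4 * w ^+ 4 * f0) + (g2 - 5 * w ^+ 2 * g1 + 4 * w ^+ 4 * g0).
Proof. by move=> <-; ring. Qed.

Lemma le_le_sum_eq (R : realFieldType) (a b c d : R) :
  a <= b -> c <= d -> a + c = b + d -> a = b /\ c = d.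
Proof. by move=> ? ? ?; split; lra. Qed.

Lemma second_order_energy (R : realType) (f f1 f2 g g1 g2 : R -> R) (L N v : R) :
  0 <= L -> continuous f2 -> continuous g2 ->
  (forall s, has_der s f (f1 s)) -> (forall s, has_der s f1 (f2 s)) ->
  (forall s, has_der s g (g1 s)) -> (forall s, has_der s g1 (g2 s)) ->
  (forall s, f (s + L) = f s) -> (forall s, g (s + L) = g s) ->
  itg 0 L (fun s => f1 s ^+ 2) + itg 0 L (fun s => g1 s ^+ 2) = N ->
  itg 0 L (fun s => (f s + v ^+ 2 * f2 s) ^+ 2 + (g s + v ^+ 2 * g2 s) ^+ 2) =
  itg 0 L (fun s => f s ^+ 2) + itg 0 L (fun s => g s ^+ 2)
  - 2 * v ^+ 2 * N
  + v ^+ 4 * (itg 0 L (fun s => f2 s ^+ 2) + itg 0 L (fun s => g2 s ^+ 2)).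
Proof.
move=> L0 cf2 cg2 df df1 dg dg1 fL gL <-.
have parts (u u1 u2 : R -> R) : (forall s, has_der s u (u1 s)) ->
    (forall s, has_der s u1 (u2 s)) -> continuous u2 -> (forall s, u (s + L) = u s) ->
    itg 0 L (fun s => u s * u2 s) = - itg 0 L (fun s => u1 s ^+ 2).
  move=> du du1 cu2 uL; have cu := der_cont du; have cu1 := der_cont du1.
  have d s : has_der s (fun s => u s * u1 s) (u1 s ^+ 2 + u s * u2 s) by der; ring.
  have : itg 0 L (fun s => u1 s ^+ 2 + u s * u2 s) = 0.
    apply: (itg_der_periodic L0 _ d); first by cont.
    have at0 (h : R -> R) : (forall s, h (s + L) = h s) -> h L = h 0.
      by move=> hL; rewrite -{1}(add0r L) hL.
    by rewrite (at0 _ uL) (at0 _ (der_periodic du uL)).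
  rewrite itgD; [|by cont|by cont].
  by move/eqP; rewrite addrC addr_eq0 => /eqP.
have cf := der_cont df; have cg := der_cont dg.
rewrite (@itg_lcomb _ [:: (1, fun s => f s ^+ 2); (1, fun s => g s ^+ 2);
  (2 * v ^+ 2, fun s => f s * f2 s); (2 * v ^+ 2, fun s => g s * g2 s);
  (v ^+ 4, fun s => f2 s ^+ 2); (v ^+ 4, fun s => g2 s ^+ 2)]) /=.
- rewrite (parts _ _ _ df df1 cf2 fL) (parts _ _ _ dg dg1 cg2 gL).
  by move: (itg _ _ _) (itg _ _ _) (itg _ _ _) (itg _ _ _) (itg _ _ _) (itg _ _ _) => *; ring.
- by conts.
- by move=> s; ring.
Qed.

Lemma itg_sum_sqr (R : realType) (f g : R -> R) a b : continuous f -> continuous g ->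
  itg a b (fun s => f s ^+ 2) + itg a b (fun s => g s ^+ 2) =
  itg a b (fun s => f s ^+ 2 + g s ^+ 2).
Proof. by move=> cf cg; rewrite itgD //; cont. Qed.

Section Isoperimetric.
Variable R : realType.
Variables (x y : R -> R) (L w : R).
Hypothesis wL : w * L = 2 * pi.
Hypothesis CC : C2_closed_unit_speed x y L.
Hypothesis simple : simple_on x y L.

Let x1 := derive1 x.
Let y1 := derive1 y.
Let x2 := derive1 x1.
Let y2 := derive1 y1.

Let L0 : 0 < L. Proof. by have [] := CC. Qed.

Let dx s : has_der s x (x1 s).
Proof. by have [_ [/(_ s)[d _] _]] := CC; have := derivableP d; rewrite -derive1E. Qed.
Let dy s : has_der s y (y1 s).
Proof. by have [_ [/(_ s)[_ [d _]] _]] := CC; have := derivableP d; rewrite -derive1E. Qed.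
Let dx1 s : has_der s x1 (x2 s).
Proof. by have [_ [/(_ s)[_ [_ [d _]]] _]] := CC; have := derivableP d; rewrite -derive1E. Qed.
Let dy1 s : has_der s y1 (y2 s).
Proof. by have [_ [/(_ s)[_ [_ [_ d]]] _]] := CC; have := derivableP d; rewrite -derive1E. Qed.
Let cx2 : continuous x2. Proof. by have [_ [_ []]] := CC. Qed.
Let cy2 : continuous y2. Proof. by have [_ [_ [_ []]]] := CC. Qed.
Let xL s : x (s + L) = x s. Proof. by have [_ [_ [_ [_ [/(_ s)[]]]]]] := CC. Qed.
Let yL s : y (s + L) = y s. Proof. by have [_ [_ [_ [_ [/(_ s)[]]]]]] := CC. Qed.
Let speed s : x1 s ^+ 2 + y1 s ^+ 2 = 1. Proof. by have [_ [_ [_ [_ [_ /(_ s)]]]]] := CC. Qed.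
Let cx1 : continuous x1. Proof. exact: der_cont dx1. Qed.
Let cy1 : continuous y1. Proof. exact: der_cont dy1. Qed.
Let cx : continuous x. Proof. exact: der_cont dx. Qed.
Let cy : continuous y. Proof. exact: der_cont dy. Qed.

Let pi0 : 0 < pi :> R. Proof. exact: pi_gt0. Qed.
Let LN0 : L != 0. Proof. exact: lt0r_neq0. Qed.
Let piN0 : pi != 0 :> R. Proof. exact: lt0r_neq0. Qed.
Let w0 : 0 < w. Proof. exact: w_gt0 L0 wL. Qed.
Let wN0 : w != 0. Proof. exact: lt0r_neq0. Qed.

Let gx := Gx x L.
Let gy := Gy y L.
Let f s := x s - gx.
Let g s := y s - gy.
Let df s : has_der s f (x1 s). Proof. by rewrite /f; der; ring. Qed.
Let dg s : has_der s g (y1 s). Proof. by rewrite /g; der; ring. Qed.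
Let cf : continuous f. Proof. exact: der_cont df. Qed.
Let cg : continuous g. Proof. exact: der_cont dg. Qed.
Let fL s : f (s + L) = f s. Proof. by rewrite /f xL. Qed.
Let gL s : g (s + L) = g s. Proof. by rewrite /g yL. Qed.

Let centered (h : R -> R) : continuous h ->
  itg 0 L (fun s => h s - L^-1 * sint L h) = 0.
Proof.
move=> ch; rewrite itgD //; last exact: cont_cst.
by rewrite itg_cst ?(ltW L0) // subr0 mulNr mulrAC mulVf // mul1r addrN.
Qed.

Let If : itg 0 L f = 0. Proof. exact: centered cx. Qed.
Let Ig : itg 0 L g = 0. Proof. exact: centered cy. Qed.

Let E0 := itg 0 L (fun s => f s ^+ 2) + itg 0 L (fun s => g s ^+ 2).
Let E2 := itg 0 L (fun s => x2 s ^+ 2) + itg 0 L (fun s => y2 s ^+ 2).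
Let Q := E2 - 5 * w ^+ 2 * L + 4 * w ^+ 4 * E0.

Let E0E : E0 = itg 0 L (fun s => f s ^+ 2 + g s ^+ 2).
Proof. exact: (itg_sum_sqr 0 L cf cg). Qed.

Let E2E : E2 = itg 0 L (fun s => x2 s ^+ 2 + y2 s ^+ 2).
Proof. exact: (itg_sum_sqr 0 L cx2 cy2). Qed.

Let itg_speed : itg 0 L (fun s => x1 s ^+ 2) + itg 0 L (fun s => y1 s ^+ 2) = L.
Proof.
apply: etrans (itg_sum_sqr 0 L cx1 cy1) _.
by rewrite (eq_itg _ _ speed) itg_cst ?(ltW L0) // subr0 mul1r.
Qed.

Lemma center_energyE : itg 0 L (fun s => sqnorm (x s - gx) (y s - gy)) = E0.
Proof. exact/esym/E0E. Qed.

Lemma area_unit_speed (A : R) : ccw x y L -> area2 (enclosed x y L) = A%:E ->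
  A = - itg 0 L (fun s => x1 s * y s).
Proof.
move=> wind areaE; have [M M0 XM] := curve_bounded L0 dx dy xL yL.
(* Adding 1 supplies the strict bound on [y] that the area formula asks for. *)
have M1 : 0 < M + 1 by rewrite addr_gt0.
have XM1 s : `|x s| <= M + 1 /\ `|y s| <= M + 1.
  by have [? ?] := XM s; split; apply: le_trans (_ : M <= _); rewrite ?lerDl.
have yM1 s : - (M + 1) < y s < M + 1.
  by rewrite -ltr_norml; have [_ yM] := XM s; apply: le_lt_trans yM _; rewrite ltrDl.
exact: (area_formula L0 dx dy cx1 cy1 xL yL speed M1 XM1 yM1 wind areaE).
Qed.

Lemma center_energy_le : w ^+ 2 * E0 <= L.
Proof.
have Wf := wirtinger L0 wL cx2 df dx1 fL If; have Wg := wirtinger L0 wL cy2 dg dy1 gL Ig.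
by rewrite /E0 mulrDr; apply: le_trans (lerD Wf Wg) _; rewrite itg_speed.
Qed.

Lemma quartic_energy_ge0 : 0 <= Q.
Proof.
have := quartic_wirtinger L0 wL cx2 df dx1 fL If.
have := quartic_wirtinger L0 wL cy2 dg dy1 gL Ig.
rewrite /Q /E2 /E0 (quartic_form_split _ _ _ _ _ itg_speed) => Qg Qf.
exact: addr_ge0 Qf Qg.
Qed.

(** Turns identities along the curve into identities on the whole unit circle, and later provides
    the parameter of a given point of the circle. *)
Let at_angle p q : p ^+ 2 + q ^+ 2 = 1 -> exists s,
  [/\ 0 <= s <= L, cos (w * s) = p & sin (w * s) = q].
Proof.
move=> /angle_of_unit_vector[t [t0 t2 tp tq]]; exists (t / w).
have -> : w * (t / w) = t by field.
split => //; rewrite divr_ge0 ?(ltW w0) //= ler_pdivrMr // mulrC wL.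
exact: ltW.
Qed.

(** A single first mode traces an ellipse; unit speed makes its coefficient vectors orthogonal and
    of equal length [1 / w], so it is a circle of that radius. *)
Lemma few_modes_circle (a b c d a' b' c' d' : R) :
  (forall s, f s = a * cos (w * s) + b * sin (w * s) +
    (c * cos (2 * w * s) + d * sin (2 * w * s))) ->
  (forall s, g s = a' * cos (w * s) + b' * sin (w * s) +
    (c' * cos (2 * w * s) + d' * sin (2 * w * s))) ->
  is_circle (curve_set x y L).
Proof.
move=> fE gE.
have der_modes (h h1 : R -> R) p q r t : (forall s, has_der s h (h1 s)) ->
    (forall s, h s = p * cos (w * s) + q * sin (w * s) +
      (r * cos (2 * w * s) + t * sin (2 * w * s))) ->
    forall s, h1 s = w * q * cos (w * s) + - (w * p) * sin (w * s) +
      (2 * w * t * cos (2 * w * s) + - (2 * w * r) * sin (2 * w * s)).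
  move=> dh hE s; have [_ <-] := dh s.
  have -> : h = (fun s => p * cos (w * s) + q * sin (w * s) +
      (r * cos (2 * w * s) + t * sin (2 * w * s))) by exact/funext.
  have [_ ->] // : has_der s (fun s => p * cos (w * s) + q * sin (w * s) +
      (r * cos (2 * w * s) + t * sin (2 * w * s)))
    (w * q * cos (w * s) + - (w * p) * sin (w * s) +
      (2 * w * t * cos (2 * w * s) + - (2 * w * r) * sin (2 * w * s))).
  by der; ring.
have x1E := der_modes _ _ _ _ _ _ df fE; have y1E := der_modes _ _ _ _ _ _ dg gE.
have dbl s : 2 * w * s = (w * s) *+ 2 by ring.
have [|UV UVn Zero] := @unit_tangent_modes R (w * b) (w * b') (- (w * a)) (- (w * a'))
    (2 * w * d) (2 * w * d') (- (2 * w * c)) (- (2 * w * c')).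
  move=> p q /at_angle[s [_ sp sq]]; rewrite -[RHS](speed s) x1E y1E (dbl s).
  by rewrite cos_mulr2n sin_mulr2n sp sq; ring.
(* Without a first mode the period would be [L / 2], against simplicity. *)
have [nE|n0] := eqVneq ((w * b) ^+ 2 + (w * b') ^+ 2) 0.
  have sq0 (u v : R) : (w * u) ^+ 2 + (w * v) ^+ 2 = 0 -> u = 0 /\ v = 0.
    move/eqP; rewrite paddr_eq0 ?sqr_ge0 // !sqrf_eq0 !mulf_eq0 (negPf wN0) /=.
    by move=> /andP[/eqP -> /eqP ->].
  have [b0 b0'] := sq0 _ _ nE.
  have [a0 a0'] : a = 0 /\ a' = 0 by apply: sq0; rewrite -nE UVn !sqrrN.
  have w2 : 2 * w * (L / 2) = pi *+ 2.
    by transitivity (w * L); [field|rewrite wL mulr_natl].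
  have xx : x 0 = x (L / 2).
    apply: (@addIr _ (- gx)); rewrite -!/(f _) !fE a0 b0 w2 !mulr0 cos2pi sin2pi cos0 sin0.
    by ring.
  have yy : y 0 = y (L / 2).
    apply: (@addIr _ (- gy)); rewrite -!/(g _) !gE a0' b0' w2 !mulr0 cos2pi sin2pi cos0 sin0.
    by ring.
  have Lp := L0.
  have : 0 = L / 2 by apply: simple; rewrite ?xx ?yy // in_itv /=; lra.
  by move=> E; exfalso; lra.
have [n1 d0 d0' c0 c0'] := Zero n0.
have half0 (u : R) : 2 * w * u = 0 -> u = 0.
  by move/eqP; rewrite !mulf_eq0 pnatr_eq0 (negPf wN0) /= => /eqP.
have {}d0 := half0 _ d0; have {}d0' := half0 _ d0'.
have {}c0 : c = 0 by apply: half0; rewrite -[LHS]opprK c0 oppr0.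
have {}c0' : c' = 0 by apply: half0; rewrite -[LHS]opprK c0' oppr0.
pose r := w^-1; have r0 : 0 < r by rewrite invr_gt0.
have wr : w * r = 1 by rewrite mulfV.
have bn : b ^+ 2 + b' ^+ 2 = r ^+ 2.
  rewrite -[LHS]mul1r -(expr1n _ 2) -wr -[RHS]mulr1 -n1; ring.
have an : a ^+ 2 + a' ^+ 2 = r ^+ 2.
  have n1' : (w * a) ^+ 2 + (w * a') ^+ 2 = 1 by rewrite -n1 UVn !sqrrN.
  rewrite -[LHS]mul1r -(expr1n _ 2) -wr -[RHS]mulr1 -n1'; ring.
have ab : a * b + a' * b' = 0.
  apply/eqP; rewrite -(mulrI_eq0 _ (mulfI (_ : w ^+ 2 != 0))) ?sqrf_eq0 //; apply/eqP.
  by rewrite -[RHS]oppr0 -UV; ring.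
exists (gx, gy), r; split => //; apply/seteqP; split => [_ [s _ <-]|[u v]] /=.
  rewrite /sqnorm -/(f s) -/(g s) fE gE c0 c0' d0 d0' !mul0r !addr0.
  transitivity ((a ^+ 2 + a' ^+ 2) * cos (w * s) ^+ 2 + (b ^+ 2 + b' ^+ 2) * sin (w * s) ^+ 2
      + 2 * (a * b + a' * b') * (cos (w * s) * sin (w * s))); first by ring.
  by rewrite an bn ab mulr0 mul0r addr0 -mulrDr cos2Dsin2 mulr1.
rewrite /sqnorm; set u' := u - gx; set v' := v - gy => uv.
(* [D] is the orientation, 1 or -1: the sine vector is [D] times the cosine vector turned by a right
   angle. The numbers [p], [q] below are the coordinates of the given point in this orthogonal
   frame. *)
pose D := w ^+ 2 * (a * b' - a' * b).
have bD : b = - a' * D.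
  transitivity (w ^+ 2 * (a ^+ 2 + a' ^+ 2) * b - w ^+ 2 * a * (a * b + a' * b')).
    by rewrite ab an -exprMn wr expr1n; ring.
  by rewrite /D; ring.
have bD' : b' = a * D.
  transitivity (w ^+ 2 * (a ^+ 2 + a' ^+ 2) * b' - w ^+ 2 * a' * (a * b + a' * b')).
    by rewrite ab an -exprMn wr expr1n; ring.
  by rewrite /D; ring.
have D2 : D ^+ 2 = 1.
  apply: (@mulfI _ (r ^+ 2)); first by rewrite sqrf_eq0 lt0r_neq0.
  rewrite mulr1; transitivity (b ^+ 2 + b' ^+ 2); last exact: bn.
  by rewrite -an [in RHS]bD [in RHS]bD'; ring.
pose p := w ^+ 2 * (a * u' + a' * v'); pose q := w ^+ 2 * (b * u' + b' * v').
have w2r : w ^+ 2 * r ^+ 2 = 1 by rewrite -exprMn wr expr1n.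
have pq : p ^+ 2 + q ^+ 2 = 1.
  transitivity (w ^+ 2 * (w ^+ 2 * (a ^+ 2 + a' ^+ 2)) * (u' ^+ 2 + v' ^+ 2)
      + w ^+ 2 * w ^+ 2 * (D ^+ 2 - 1) * (a' * u' - a * v') ^+ 2).
    by rewrite /p /q bD bD'; ring.
  by rewrite D2 uv an w2r mulr1 w2r subrr; ring.
have [s [sL sp sq]] := at_angle pq.
exists s; first by rewrite /= in_itv.
have fu : f s = u'.
  rewrite fE c0 d0 !mul0r !addr0 sp sq /p /q.
  transitivity (w ^+ 2 * (a ^+ 2 + a' ^+ 2) * u' + w ^+ 2 * (D ^+ 2 - 1) * a' * (a' * u' - a * v')).
    by rewrite bD bD'; ring.
  by rewrite an w2r D2; ring.
have gv : g s = v'.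
  rewrite gE c0' d0' !mul0r !addr0 sp sq /p /q.
  transitivity (w ^+ 2 * (a ^+ 2 + a' ^+ 2) * v' + w ^+ 2 * (D ^+ 2 - 1) * a * (a * v' - a' * u')).
    by rewrite bD bD'; ring.
  by rewrite an w2r D2; ring.
by congr (_, _); [apply: (@addIr _ (- gx))|apply: (@addIr _ (- gy))].
Qed.

Lemma center_energy_eq : w ^+ 2 * E0 = L -> is_circle (curve_set x y L).
Proof.
move=> E; have Wf := wirtinger L0 wL cx2 df dx1 fL If.
have Wg := wirtinger L0 wL cy2 dg dy1 gL Ig.
rewrite /E0 mulrDr -[RHS]itg_speed in E.
have [Ef Eg] := le_le_sum_eq Wf Wg E.
have [a [b fE]] := wirtinger_eq L0 wL cx2 df dx1 fL If Ef.
have [a' [b' gE]] := wirtinger_eq L0 wL cy2 dg dy1 gL Ig Eg.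
by apply: (@few_modes_circle a b 0 0 a' b' 0 0) => s; rewrite ?fE ?gE; ring.
Qed.

Lemma quartic_energy_eq : Q = 0 -> is_circle (curve_set x y L).
Proof.
have Qf := quartic_wirtinger L0 wL cx2 df dx1 fL If.
have Qg := quartic_wirtinger L0 wL cy2 dg dy1 gL Ig.
rewrite /Q /E2 /E0 (quartic_form_split _ _ _ _ _ itg_speed).
move=> /eqP; rewrite (paddr_eq0 Qf Qg) => /andP[/eqP Qf0 /eqP Qg0].
have [a [b [c [d fE]]]] := quartic_wirtinger_eq L0 wL cx2 df dx1 fL If Qf0.
have [a' [b' [c' [d' gE]]]] := quartic_wirtinger_eq L0 wL cy2 dg dy1 gL Ig Qg0.
exact: few_modes_circle fE gE.
Qed.

(** Only the image is known to be a circle. Constant distance from the centre makes the motion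
    harmonic with frequency [1 / r]; closedness and simplicity then fix the length. *)
Lemma circle_energies : is_circle (curve_set x y L) -> w ^+ 2 * E0 = L /\ Q = 0.
Proof.
move=> [[c1 c2] [r [r0 CE]]].
pose h s := x s - c1; pose k s := y s - c2.
have dh s : has_der s h (x1 s) by rewrite /h; der; ring.
have dk s : has_der s k (y1 s) by rewrite /k; der; ring.
have ch : continuous h := der_cont dh. have ck : continuous k := der_cont dk.
have rN0 : r != 0 := lt0r_neq0 r0.
have hk s : h s ^+ 2 + k s ^+ 2 = r ^+ 2.
  have := curve_point L0 xL yL s; rewrite CE /=; by [].
have der0 (u u1 : R -> R) (z : R) : (forall s, has_der s u (u1 s)) -> (forall s, u s = z) ->
    forall s, u1 s = 0.
  move=> du uz s; have [_ <-] := du s; have -> : u = (fun=> z) by exact/funext.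
  by have [_ ->] := der_cst z s.
have perp s : h s * x1 s + k s * y1 s = 0.
  have d t : has_der t (fun t => h t ^+ 2 + k t ^+ 2) (2 * (h t * x1 t + k t * y1 t)).
    by der; ring.
  have := der0 _ _ _ d hk s => /eqP; rewrite mulf_eq0 pnatr_eq0 /= => /eqP //.
have acc s : x1 s * x2 s + y1 s * y2 s = 0.
  have d t : has_der t (fun t => x1 t ^+ 2 + y1 t ^+ 2) (2 * (x1 t * x2 t + y1 t * y2 t)).
    by der; ring.
  have := der0 _ _ _ d speed s => /eqP; rewrite mulf_eq0 pnatr_eq0 /= => /eqP //.
(* The normal component of the radius vector, which is purely normal by [perp]. It is constant
   because the acceleration is normal too, and equals [r] or [- r]. *)
pose m s := h s * y1 s - k s * x1 s.
have hm s : h s = m s * y1 s.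
  transitivity (h s * (x1 s ^+ 2 + y1 s ^+ 2)); first by rewrite speed mulr1.
  transitivity ((h s * x1 s + k s * y1 s) * x1 s + m s * y1 s); first by rewrite /m; ring.
  by rewrite perp mul0r add0r.
have km s : k s = - (m s * x1 s).
  transitivity (k s * (x1 s ^+ 2 + y1 s ^+ 2)); first by rewrite speed mulr1.
  transitivity ((h s * x1 s + k s * y1 s) * y1 s - m s * x1 s); first by rewrite /m; ring.
  by rewrite perp mul0r add0r.
have mE s : m s = m 0.
  apply: is_derive_0_is_cst => t; apply: (@has_der_eq _ t m (h t * y2 t - k t * x2 t)).
    by rewrite /m; der; ring.
  by rewrite hm km -[RHS](mulr0 (m t)) -(acc t); ring.
have m2 : m 0 ^+ 2 = r ^+ 2.
  rewrite -(hk 0) hm km -[LHS]mulr1 -(speed 0); ring.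
have mN0 : m 0 != 0 by rewrite -sqrf_eq0 m2 sqrf_eq0.
have x1m s : x1 s = m 0 * y2 s.
  have d t : has_der t (fun t => h t - m 0 * y1 t) (x1 t - m 0 * y2 t) by der; ring.
  have z t : h t - m 0 * y1 t = 0 by rewrite hm mE subrr.
  by have := der0 _ _ _ d z s => /eqP; rewrite subr_eq0 => /eqP.
have y1m s : y1 s = - (m 0 * x2 s).
  have d t : has_der t (fun t => k t + m 0 * x1 t) (y1 t + m 0 * x2 t) by der; ring.
  have z t : k t + m 0 * x1 t = 0 by rewrite km mE addNr.
  by have := der0 _ _ _ d z s => /eqP; rewrite addr_eq0 => /eqP.
have hx2 s : x2 s = - (r^-1) ^+ 2 * h s.
  apply: (mulfI mN0); rewrite -[LHS]opprK -y1m hm mE.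
  by rewrite exprVn -m2; field.
have ky2 s : y2 s = - (r^-1) ^+ 2 * k s.
  by apply: (mulfI mN0); rewrite -x1m km mE exprVn -m2; field.
have x1L := der_periodic dx xL; have y1L := der_periodic dy yL.
have at0 (u u1 : R -> R) : (forall s, u (s + L) = u s) -> u L = u 0.
  by move=> uL; rewrite -{1}(add0r L) uL.
have Ix2 : itg 0 L x2 = 0 := itg_der_periodic (ltW L0) cx2 dx1 (at0 _ x1 x1L).
have Iy2 : itg 0 L y2 = 0 := itg_der_periodic (ltW L0) cy2 dy1 (at0 _ x1 y1L).
have rV : r^-1 ^+ 2 != 0 by rewrite sqrf_eq0 invr_eq0.
(* Integrating the harmonic equation over a period identifies the centre of gravity with the centre
   of the circle. *)
have center (u u2 : R -> R) c : continuous u -> (forall s, u2 s = - (r^-1) ^+ 2 * (u s - c)) ->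
    itg 0 L u2 = 0 -> L^-1 * sint L u = c.
  move=> cu uE Iu; have : itg 0 L (fun s => u s - c) = 0.
    apply/eqP; rewrite -(mulrI_eq0 _ (mulfI (_ : - (r^-1) ^+ 2 != 0))) ?oppr_eq0 //.
    by rewrite -itgZ; [rewrite -(eq_itg _ _ uE) Iu|cont].
  rewrite itgD //; last exact: cont_cst.
  rewrite itg_cst ?(ltW L0) // subr0 => /eqP; rewrite mulNr subr_eq0 => /eqP E.
  by rewrite /sint -/(itg 0 L u) E mulrC mulfK.
have gxE : gx = c1 by exact: (center x x2).
have gyE : gy = c2 by exact: (center y y2).
have fh s : f s = h s by rewrite /f gxE.
have gk s : g s = k s by rewrite /g gyE.
have E0r : E0 = r ^+ 2 * L.
  rewrite E0E.
  rewrite (eq_itg (g := fun=> r ^+ 2)) ?itg_cst ?(ltW L0) // ?subr0 //.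
  by move=> s; rewrite fh gk.
have E2r : E2 = r^-1 ^+ 2 * L.
  rewrite E2E.
  rewrite (eq_itg (g := fun=> r^-1 ^+ 2)) ?itg_cst ?(ltW L0) // ?subr0 //.
  move=> s; rewrite hx2 ky2 -[RHS]mul1r -(mulfV (_ : r ^+ 2 != 0)) ?sqrf_eq0 //.
  by rewrite -(hk s) exprVn -(hk s); ring.
have rk : r^-1 != 0 by rewrite invr_eq0.
have hode := harmonic_ode rk dh dx1 hx2.
have kode := harmonic_ode rk dk dy1 ky2.
(* If [L] were larger, the curve would return to its starting point before time [L]; if it were
   smaller, closing up at [L] would force [cos (L / r) = 1] strictly inside one turn. *)
have Lr : L = 2 * pi * r.
  apply/eqP; rewrite eq_le; apply/andP; split; rewrite leNgt; apply/negP => Lt.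
    have w2 : r^-1 * (2 * pi * r) = pi *+ 2 by rewrite -mulr_natl; field.
    have hx : x (2 * pi * r) = x 0.
      by apply: (@addIr _ (- c1)); rewrite -!/(h _) hode w2 cos2pi sin2pi mulr1 mulr0 addr0.
    have ky : y (2 * pi * r) = y 0.
      by apply: (@addIr _ (- c2)); rewrite -!/(k _) kode w2 cos2pi sin2pi mulr1 mulr0 addr0.
    have tp : 0 < 2 * pi * r by rewrite !mulr_gt0.
    have : 2 * pi * r = 0.
      by apply: simple; rewrite ?hx ?ky // in_itv /= ?lexx ?Lt ?(ltW tp) ?L0.
    by move/eqP; rewrite gt_eqF.
  have hL0 : h L = h 0 by rewrite /h (at0 x x xL).
  have kL0 : k L = k 0 by rewrite /k (at0 y y yL).
  have c1E : cos (r^-1 * L) = 1.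
    apply: (mulfI (_ : r ^+ 2 != 0)); first by rewrite sqrf_eq0.
    rewrite mulr1; transitivity (h 0 * h L + k 0 * k L); last by rewrite hL0 kL0 -!expr2 hk.
    rewrite (hode L) (kode L) -(hk 0).
    transitivity ((h 0 ^+ 2 + k 0 ^+ 2) * cos (r^-1 * L) +
      (h 0 * x1 0 + k 0 * y1 0) * (sin (r^-1 * L) / r^-1)); last by ring.
    by rewrite perp mul0r addr0.
  move/eqP: c1E; apply/negP/cos_lt1; first by rewrite mulr_gt0 ?invr_gt0.
  by rewrite mulrC ltr_pdivrMr.
have wr : w = r^-1.
  apply: (mulIf LN0); rewrite wL Lr; move: piN0 rN0; move: (pi : R) => P P0 r0'.
  by field.
split; first by rewrite E0r wr; field.
by rewrite /Q E0r E2r wr; field.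
Qed.

Lemma normal_energy (A : R) : A = - itg 0 L (fun s => x1 s * y s) ->
  itg 0 L (fun s => sqnorm (x s - gx - w^-1 * Nx y s) (y s - gy - w^-1 * Ny x s)) =
  E0 - 4 * w^-1 * A + w^-1 ^+ 2 * L.
Proof.
move=> AE; have at0 (u : R -> R) : (forall s, u (s + L) = u s) -> u L = u 0.
  by move=> uL; rewrite -{1}(add0r L) uL.
have Ix1 : itg 0 L x1 = 0 := itg_der_periodic (ltW L0) cx1 dx (at0 _ xL).
have Igx : itg 0 L (fun s => x1 s * g s) = - A.
  rewrite (@itg_lcomb _ [:: (1, fun s => x1 s * y s); (- gy, x1)]) /=.
  - by rewrite Ix1 AE; ring.
  - by conts.
  - by move=> s; rewrite /g; ring.
have Ify : itg 0 L (fun s => f s * y1 s) = A.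
  have d s : has_der s (fun s => f s * g s) (x1 s * g s + f s * y1 s) by der; ring.
  have : itg 0 L (fun s => x1 s * g s + f s * y1 s) = 0.
    apply: (itg_der_periodic (ltW L0) _ d); first by cont.
    by rewrite (at0 _ fL) (at0 _ gL).
  rewrite itgD; [|by cont|by cont].
  by rewrite Igx => /eqP; rewrite addrC subr_eq0 => /eqP.
rewrite (@itg_lcomb _ [:: (1, fun s => f s ^+ 2); (1, fun s => g s ^+ 2);
  (- 2 * w^-1, fun s => f s * y1 s); (2 * w^-1, fun s => x1 s * g s);
  (w^-1 ^+ 2, fun=> 1)]) /=.
- rewrite Igx Ify itg_cst ?(ltW L0) // /E0; move: (itg _ _ _) (itg _ _ _) => a b.
  by move: w^-1 => v; ring.
- by conts.
- move=> s; rewrite /sqnorm /Nx /Ny -/(f s) -/(g s) -/(x1 s) -/(y1 s); move: w^-1 => v.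
  transitivity (f s ^+ 2 + g s ^+ 2 - 2 * v * (f s * y1 s) + 2 * v * (x1 s * g s) +
    v ^+ 2 * (x1 s ^+ 2 + y1 s ^+ 2)); first by ring.
  by rewrite speed; ring.
Qed.

Let acceleration s : x1 s * x2 s + y1 s * y2 s = 0.
Proof.
have d t : has_der t (fun t => x1 t ^+ 2 + y1 t ^+ 2) (2 * (x1 t * x2 t + y1 t * y2 t)).
  by der; ring.
have [_ E] := d s; move: E; rewrite (_ : (fun t => _) = (fun=> 1)); last by exact/funext.
by have [_ ->] := der_cst 1 s => /esym/eqP; rewrite mulf_eq0 pnatr_eq0 /= => /eqP.
Qed.

Let k := curvature x y.

(** The acceleration is orthogonal to the unit tangent, so the determinant defining the curvature
    recovers all of it; together with [ky] this eliminates the curvature from the energies. *)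
Let kx s : k s * y1 s = - x2 s.
Proof.
rewrite /k /curvature -/x1 -/y1 -/x2 -/y2.
transitivity (y1 s * (x1 s * x2 s + y1 s * y2 s) * 0 + (x1 s * (x1 s * x2 s + y1 s * y2 s)
  - (x1 s ^+ 2 + y1 s ^+ 2) * x2 s)); first by rewrite mulr0; ring.
by rewrite acceleration speed !(mulr0, mul1r) !add0r.
Qed.

Let ky s : k s * - x1 s = - y2 s.
Proof.
rewrite /k /curvature -/x1 -/y1 -/x2 -/y2.
transitivity (y1 s * (x1 s * x2 s + y1 s * y2 s) - (x1 s ^+ 2 + y1 s ^+ 2) * y2 s).
  by ring.
by rewrite acceleration speed mulr0 mul1r add0r.
Qed.

Lemma curvature_energy : itg 0 L (fun s => k s ^+ 2) = E2.
Proof.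
rewrite E2E; apply: eq_itg => s.
have -> : x2 s = - (k s * y1 s) by rewrite kx opprK.
have -> : y2 s = k s * x1 s by rewrite -[RHS]opprK -mulrN ky opprK.
by rewrite -[LHS]mulr1 -(speed s); ring.
Qed.

Lemma curvature_normal_energy :
  itg 0 L (fun s => sqnorm (x s - gx - w^-1 ^+ 2 * k s * Nx y s)
                           (y s - gy - w^-1 ^+ 2 * k s * Ny x s)) =
  E0 - 2 * w^-1 ^+ 2 * L + w^-1 ^+ 4 * E2.
Proof.
rewrite (eq_itg (g := fun s => (f s + w^-1 ^+ 2 * x2 s) ^+ 2 + (g s + w^-1 ^+ 2 * y2 s) ^+ 2)).
  exact: (second_order_energy w^-1 (ltW L0) cx2 cy2 df dx1 dg dy1 fL gL itg_speed).
have scale (a b c : R) : a * b = - c -> w^-1 ^+ 2 * a * b = - (w^-1 ^+ 2 * c).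
  by move=> abc; rewrite -mulrA abc mulrN.
have sqE (a b c d c' d' : R) : c = - c' -> d = - d' ->
    sqnorm (a - c) (b - d) = (a + c') ^+ 2 + (b + d') ^+ 2.
  by move=> -> ->; rewrite /sqnorm !opprK.
by move=> s; exact: sqE (scale _ _ _ (kx s)) (scale _ _ _ (ky s)).
Qed.

End Isoperimetric.

(** * Algebra of the coefficients *)

Section Coefficients.
Variable R : realType.
Variables (P L E0 E2 A : R).
Hypotheses (P0 : P != 0) (L0 : L != 0).
Let w := 2 * P / L.
Let X := L - w ^+ 2 * E0.
Let Q := E2 - 5 * w ^+ 2 * L + 4 * w ^+ 4 * E0.

(** Here [P] is to be instantiated by [pi], and [X] is the quantity that the overview calls P. *)
Lemma coef_Da :
  L ^+ 2 - 4 * P * A - 2 * P ^+ 2 / L * (E0 - 4 * w^-1 * A + w^-1 ^+ 2 * L) =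
  L / 2 * X.
Proof. by rewrite /X /w; field; rewrite P0 L0. Qed.

Lemma coef_Db : L ^+ 3 / (4 * P ^+ 2) - E0 = w^-1 ^+ 2 * X.
Proof. by rewrite /X /w; field; rewrite P0 L0. Qed.

Lemma coef_Ra :
  2 * P ^+ 2 / (3 * L) * (E0 - 2 * w^-1 ^+ 2 * L + w^-1 ^+ 4 * E2) - L / 2 * X =
  L / 6 * w^-1 ^+ 2 * Q.
Proof. by rewrite /X /Q /w; field; rewrite P0 L0. Qed.

Lemma coef_Rb :
  L ^+ 4 / (64 * P ^+ 4) * (E2 - 4 * P ^+ 2 / L) - w^-1 ^+ 2 * X = w^-1 ^+ 4 / 4 * Q.
Proof. by rewrite /X /Q /w; field; rewrite P0 L0. Qed.

End Coefficients.

Theorem theorem3p1 (R : realType) (x y : R -> R) (L A : R) :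
  C2_closed_unit_speed x y L ->
  simple_on x y L ->
  ccw x y L ->
  area2 (enclosed x y L) = A%:E ->
  let k := curvature x y in
  let gx := Gx x L in
  let gy := Gy y L in
  let c := L / (2 * pi) in
  let Ia := sint L (fun s => sqnorm (x s - gx - c * Nx y s)
                                    (y s - gy - c * Ny x s)) in
  let Ja := sint L (fun s => sqnorm (x s - gx - c ^+ 2 * k s * Nx y s)
                                    (y s - gy - c ^+ 2 * k s * Ny x s)) in
  let Da := (L ^+ 2 - 4 * pi * A) - 2 * pi ^+ 2 / L * Ia in
  let Ra := 2 * pi ^+ 2 / (3 * L) * Ja in
  let Db := L ^+ 3 / (4 * pi ^+ 2)
            - sint L (fun s => sqnorm (x s - gx) (y s - gy)) in
  let Rb := L ^+ 4 / (64 * pi ^+ 4)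
            * (sint L (fun s => k s ^+ 2) - 4 * pi ^+ 2 / L) in
  let C := curve_set x y L in
  [/\ 0 <= Da, Da <= Ra, 0 <= Db & Db <= Rb] /\
  [/\ (Da = 0 <-> is_circle C), (Da = Ra <-> is_circle C),
      (Db = 0 <-> is_circle C) & (Db = Rb <-> is_circle C)].

Proof.
move=> CC simple wind areaE k gx gy c Ia Ja Da Ra Db Rb C.
have L0 : 0 < L by case: CC.
have LN0 : L != 0 := lt0r_neq0 L0.
have piN0 : pi != 0 :> R := lt0r_neq0 (pi_gt0 R).
pose w := 2 * pi / L; have wL : w * L = 2 * pi by rewrite /w mulfVK.
have w0 : 0 < w := w_gt0 L0 wL.
have wV0 : 0 < w^-1 by rewrite invr_gt0.
have cw : c = w^-1 by rewrite /c /w invf_div.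
have AE : A = - itg 0 L (fun s => derive1 x s * y s) := area_unit_speed CC wind areaE.
pose E0 := itg 0 L (fun s => (x s - gx) ^+ 2) + itg 0 L (fun s => (y s - gy) ^+ 2).
pose E2 := itg 0 L (fun s => derive1 (derive1 x) s ^+ 2) +
  itg 0 L (fun s => derive1 (derive1 y) s ^+ 2).
have IaE : Ia = E0 - 4 * w^-1 * A + w^-1 ^+ 2 * L.
  by rewrite /Ia cw; exact: (normal_energy w CC AE).
have JaE : Ja = E0 - 2 * w^-1 ^+ 2 * L + w^-1 ^+ 4 * E2.
  by rewrite /Ja cw; exact: (curvature_normal_energy w CC).
have kE : sint L (fun s => k s ^+ 2) = E2 := curvature_energy CC.
have xyE : sint L (fun s => sqnorm (x s - gx) (y s - gy)) = E0 := center_energyE CC.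
pose X := L - w ^+ 2 * E0.
pose Q := E2 - 5 * w ^+ 2 * L + 4 * w ^+ 4 * E0.
have X0 : 0 <= X by rewrite subr_ge0; exact: (center_energy_le wL CC).
have Q0 : 0 <= Q := quartic_energy_ge0 wL CC.
have DaE : Da = L / 2 * X by rewrite /Da IaE; exact: coef_Da.
have DbE : Db = w^-1 ^+ 2 * X by rewrite /Db xyE; exact: coef_Db.
have RaE : Ra = Da + L / 6 * w^-1 ^+ 2 * Q.
  by rewrite DaE -(coef_Ra E0 E2 piN0 LN0) /Ra JaE [RHS]addrC subrK.
have RbE : Rb = Db + w^-1 ^+ 4 / 4 * Q.
  by rewrite DbE -(coef_Rb E0 E2 piN0 LN0) /Rb kE [RHS]addrC subrK.
have ka : 0 < L / 2 by rewrite divr_gt0.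
have kb : 0 < w^-1 ^+ 2 by rewrite exprn_gt0.
have kra : 0 < L / 6 * w^-1 ^+ 2 by rewrite mulr_gt0 // divr_gt0.
have krb : 0 < w^-1 ^+ 4 / 4 by rewrite divr_gt0 // exprn_gt0.
have XC : X = 0 <-> is_circle C.
  split => [/eqP|/(circle_energies wL CC simple)[XE _]].
    by rewrite subr_eq0 eq_sym => /eqP /(center_energy_eq wL CC simple).
  by rewrite /X /E0 XE subrr.
have QC : Q = 0 <-> is_circle C.
  split => [/(quartic_energy_eq wL CC simple)//|].
  by move=> /(circle_energies wL CC simple)[_].
have pos (u v : R) : 0 < u -> (u * v = 0) <-> (v = 0).
  move=> u0; split => [/eqP|->]; last by rewrite mulr0.
  by rewrite mulf_eq0 gt_eqF //= => /eqP.
have gap (u v : R) : (u = u + v) <-> (v = 0).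
  by split => [/eqP|->]; rewrite ?addr0 // -{1}[u]addr0 (inj_eq (addrI u)) eq_sym => /eqP.
split; split.
- by rewrite DaE mulr_ge0 // ltW.
- by rewrite RaE lerDl mulr_ge0 // ltW.
- by rewrite DbE mulr_ge0 // ltW.
- by rewrite RbE lerDl mulr_ge0 // ltW.
- by rewrite DaE; apply: iff_trans XC; exact: pos.
- by rewrite RaE; apply: iff_trans (gap _ _) _; apply: iff_trans QC; exact: pos.
- by rewrite DbE; apply: iff_trans XC; exact: pos.
- by rewrite RbE; apply: iff_trans (gap _ _) _; apply: iff_trans QC; exact: pos.
Qed.
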